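(* Let $n\ge3$ be odd, and let $A$ be the $(n-1)\times(n-1)$ block-diagonal matrix consisting of $\frac{n-1}{2}$ copies of $J_2(0)=\begin{bmatrix}0&1\\0&0\end{bmatrix}$. Consider spacetimes $I\times G$ ($I\subset\mathbb{R}$ an open interval) with diagonal metrics $-N^2dt^2+\sum_{i=1}^n a_i^2(\omega^i)^2$, where $N,a_1,\dots,a_n$ are positive functions of $t$, $G$ is the Lie group with almost abelian Lie algebra associated with $A$, and $$\omega^{2p-1}=dx_{2p-1}-x_n\,dx_{2p},\qquad \omega^{2p}=dx_{2p}\quad\left(p=1,\dots,\tfrac{n-1}{2}\right),\qquad \omega^n=dx_n$$ are its left-invariant $1$-forms. The solution of the vacuum Einstein equations (with zero cosmological constant, i.e. of the Ricci-flat condition) is $$ds^2=\cosh^{\frac{n-1}{2}}(kt)\left(-c_0^2e^{2(\mathrm{tr}\,h)t}dt^2+c_n^2e^{2h_nt}(\omega^n)^2\right)+\sum_{p=1}^{\frac{n-1}{2}}\left[\frac{c_{2p-1}^2e^{2h_{2p-1}t}}{\cosh(kt)}(\omega^{2p-1})^2+c_{2p}^2e^{2h_{2p}t}\cosh(kt)(\omega^{2p})^2\right],$$ where $c_0,\dots,c_n$ are positive constants, $h_1,\dots,h_n$ are real constants, $h=\mathrm{diag}(h_1,\dots,h_n)$, and $$k=\frac{c_0c_1}{c_2c_n},\qquad \frac{c_1}{c_2}=\frac{c_3}{c_4}=\cdots=\frac{c_{n-2}}{c_{n-1}},\qquad (\mathrm{tr}\,h)^2-\mathrm{tr}(h^2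)=\frac{n-1}{4}k^2.$$
   Context: The almost abelian Lie algebra associated with an $(n-1)\times(n-1)$ matrix $A$ has a basis $X_1,\dots,X_n$ with $[X_n,X_j]=\sum_{k=1}^{n-1}A_{kj}X_k$ for $1\le j\le n-1$ and all brackets among $X_1,\dots,X_{n-1}$ zero; $\omega^1,\dots,\omega^n$ are the dual left-invariant $1$-forms, written in coordinates $x_1,\dots,x_n$. Metrics are assumed diagonal, and it is not claimed that the diagonal solutions are general.
   Formalization: The displayed metric is shown Ricci-flat iff also h_{2p-1}+tr h=h_{2p}+h_n for all p (needed: n=3 forces h_1=0); that every solution has this form, up to a change of t, is shown assuming a_1/a_2=a_3/a_4=… (else false for n≥5). *)

(* Defs.v *)
From HB Require Import structures.
From mathcomp Require Import all_boot all_order all_algebra.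
From mathcomp Require Import all_classical all_reals all_analysis.
From mathcomp Require Import ring.

Set Implicit Arguments.
Unset Strict Implicit.
Unset Printing Implicit Defensive.

Import Order.TTheory GRing.Theory Num.Theory.
Import numFieldNormedType.Exports.

Local Open Scope classical_set_scope.
Local Open Scope ring_scope.

Section CoordinateGeometry.
Context {R : realType} {d : nat}.

Definition partial (i : 'I_d.+1) (f : 'rV[R]_d.+1 -> R) (y : 'rV[R]_d.+1) : R :=
  'D_(delta_mx ord0 i) f y.

(* A metric on R^(d+1) is given by its matrix of components in the coordinate
   frame, and [christoffel g k i j] is Gamma^k_{ij}. *)
Definition christoffel (g : 'rV[R]_d.+1 -> 'M[R]_d.+1)
    (k i j : 'I_d.+1) (y : 'rV[R]_d.+1) : R :=
  2^-1 * \sum_l invmx (g y) k l *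
    (partial i (fun z => g z j l) y + partial j (fun z => g z i l) y
     - partial l (fun z => g z i j) y).

Definition ricci (g : 'rV[R]_d.+1 -> 'M[R]_d.+1)
    (i j : 'I_d.+1) (y : 'rV[R]_d.+1) : R :=
  \sum_k (partial k (christoffel g k i j) y
          - partial j (christoffel g k i k) y)
  + \sum_k \sum_l (christoffel g k k l y * christoffel g l i j y
                   - christoffel g k j l y * christoffel g l i k y).

(* Coordinate 0 is the time coordinate. *)
Definition ricci_flat_on (I : set R) (g : 'rV[R]_d.+1 -> 'M[R]_d.+1) : Prop :=
  forall y : 'rV[R]_d.+1, I (y ord0 ord0) -> forall i j, ricci g i j y = 0.

(* Pullback of g by the time change (s, x) |-> (tau s, x), whose Jacobian
   matrix is diag(tau'(s), 1, ..., 1). *)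
Definition time_pullback (tau : R -> R) (g : 'rV[R]_d.+1 -> 'M[R]_d.+1)
    (y : 'rV[R]_d.+1) : 'M[R]_d.+1 :=
  let s := y ord0 ord0 in
  let y' := \row_i (if i == ord0 then tau s else y ord0 i) in
  let D := diag_mx (\row_i (if i == ord0 then derive1 tau s else 1)) in
  D *m g y' *m D.

(* Commutator of vector fields, given by their components. *)
Definition lie_bracket (X Y : 'rV[R]_d.+1 -> 'rV[R]_d.+1)
    (y : 'rV[R]_d.+1) : 'rV[R]_d.+1 :=
  \row_j \sum_i (X y ord0 i * partial i (fun z => Y z ord0 j) y
                 - Y y ord0 i * partial i (fun z => X z ord0 j) y).

End CoordinateGeometry.

(* I x G is covered by coordinates (t, x_1, ..., x_n), a point being a row
   vector y of length n+1 with y_0 = t and y_i = x_i.  Families indexed by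
   1, ..., n are functions on nat whose other values are irrelevant. *)
Section Model.
Context {R : realType}.
Variable n : nat.

Definition dcoord (i : nat) : 'rV[R]_n.+1 := delta_mx ord0 (inord i).

(* For n odd, the odd i < n are the indices 2p-1 with 1 <= p <= (n-1)/2. *)
Definition omega (i : nat) (y : 'rV[R]_n.+1) : 'rV[R]_n.+1 :=
  if odd i && (i < n)%N then dcoord i - y ord0 ord_max *: dcoord i.+1
  else dcoord i.

(* The tensor square of a 1-form. *)
Definition sq (w : 'rV[R]_n.+1) : 'M[R]_n.+1 := w^T *m w.

Definition diag_metric (N : R -> R) (a : nat -> R -> R)
    (y : 'rV[R]_n.+1) : 'M[R]_n.+1 :=
  let t := y ord0 ord0 in
  - (N t ^+ 2) *: sq (dcoord 0)
  + \sum_(1 <= i < n.+1) (a i t ^+ 2) *: sq (omega i y).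

(* Rows and columns are numbered from 0 here, so that the block J_2(0) number
   p >= 1 has its 1 in row 2p-2 and column 2p-1. *)
Definition blockJ : 'M[R]_n.-1 :=
  \matrix_(k, j) (~~ odd k && (j == k.+1 :> nat))%:R.

(* X_1, ..., X_n, the frame dual to omega. *)
Definition frame (i : nat) (y : 'rV[R]_n.+1) : 'rV[R]_n.+1 :=
  if odd i then dcoord i else dcoord i + y ord0 ord_max *: dcoord i.-1.

(* (v, r) (w, s) = (v + exp (r A) w, r + s), with exp (r A) = 1 + r A and time
   left fixed. *)
Definition left_translation (r : 'rV[R]_n.+1) (y : 'rV[R]_n.+1) :
    'rV[R]_n.+1 :=
  \row_i (if i == ord0 then y ord0 i else
          r ord0 i + y ord0 i
          + (if odd i && (i < n)%N then r ord0 ord_max * y ord0 (inord i.+1)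
             else 0)).

Let affine_partial (f : 'rV[R]_n.+1 -> R) (i : 'I_n.+1)
    (y : 'rV[R]_n.+1) (l : R) :
  (forall s, f (s *: delta_mx ord0 i + y) = f y + s * l) -> partial i f y = l.
Proof.
move=> fE; apply/cvg_lim => //.
apply: (@cvg_trans _ ((cst l : R -> R) @ 0^')); last exact: cvg_cst.
apply: near_eq_cvg; near=> s => /=.
rewrite fE addrC addKr /cst [_ *: _]mulrA mulVf ?mul1r//.
by near: s; exact: nbhs_dnbhs_neq.
Unshelve. all: by end_near. Qed.

Let coord_line s (i j : 'I_n.+1) (y : 'rV[R]_n.+1) :
  (s *: delta_mx ord0 i + y) ord0 j = y ord0 j + s * (j == i)%:R.
Proof. by rewrite !mxE eqxx addrC. Qed.

Let dcoordE (i : nat) (j : 'I_n.+1) : (i <= n)%N ->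
  dcoord i ord0 j = (j == i :> nat)%:R.
Proof. by move=> ilen; rewrite mxE eqxx -val_eqE /= inordK. Qed.

Let dcoord_dot (i j : nat) : (i <= n)%N -> (j <= n)%N ->
  dcoord i *m (dcoord j)^T = (i == j)%:R%:M.
Proof.
move=> ilen jlen; rewrite trmx_delta mul_delta_mx_cond -val_eqE /= !inordK//.
by apply/matrixP => k l; rewrite !ord1 mulrb [RHS]mxE eqxx; case: eqP; rewrite mxE.
Qed.

Lemma omega_frame (i j : nat) (y : 'rV[R]_n.+1) :
  odd n -> (i <= n)%N -> (0 < j <= n)%N ->
  omega i y *m (frame j y)^T = (i == j)%:R%:M.
Proof.
move=> on ilen /andP[j0 jlen].
have z0 : (false%:R)%:M = 0 :> 'M[R]_1 by rewrite raddf0.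
have jlen' : (j.-1 <= n)%N by rewrite (leq_trans (leq_pred _)).
rewrite /omega /frame; case: ifPn => [/andP[oi ltin]|oin]; case: ifPn => oj.
- rewrite mulmxBl -scalemxAl !dcoord_dot//.
  rewrite (_ : (i.+1 == j) = false) ?z0 ?scaler0 ?oppr0 ?addr0//.
  by apply: contraTF oj => /eqP <-; rewrite /= oi.
- rewrite raddfD/= mulmxBl !mulmxDr linearZ/= -!scalemxAl -!scalemxAr.
  have e : (i.+1 == j) = (i == j.-1) by rewrite -[in LHS](prednK j0).
  rewrite !dcoord_dot// e.
  rewrite (_ : (i == j) = false); last by apply: contraNF oj => /eqP <-.
  rewrite (_ : (i.+1 == j.-1) = false); last first.
    by apply: contraNF oj => /eqP ij; rewrite -(prednK j0) -ij /= oi.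
  by rewrite z0 !scaler0 add0r addr0 subrr.
- by rewrite dcoord_dot.
- rewrite raddfD/= mulmxDr linearZ/= -scalemxAr !dcoord_dot//.
  rewrite [i == j.-1](_ : _ = false) ?z0 ?scaler0 ?addr0//.
  apply: contraNF oin => /eqP ->.
  by case: j j0 jlen oj {jlen'} => //= j' _ -> /negbNE ->.
Qed.

Let left_translation_jacobian (r y : 'rV[R]_n.+1) (k j : 'I_n.+1) :
  partial j (fun z => left_translation r z ord0 k) y
  = (k == j)%:R + (odd k && (k < n)%N && (j == k.+1 :> nat))%:R * r ord0 ord_max.
Proof.
apply: affine_partial => s; rewrite !mxE.
have [->|k0] := eqVneq k ord0; first by rewrite eqxx /= mul0r addr0 addrC.
rewrite eqxx; case: ifPn => [/andP[ok kn]|_] /=.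
  rewrite -(val_eqE (inord _)) /= inordK// [k.+1 == _]eq_sym.
  set u := (k == j)%:R; set v := (_ == _)%:R; ring.
by rewrite mul0r; set u := (k == j)%:R; ring.
Qed.

Lemma omega_left_invariant (i : nat) (r y : 'rV[R]_n.+1) :
  odd n -> (i <= n)%N ->
  omega i (left_translation r y) *m
    (\matrix_(k, j) partial j (fun z => left_translation r z ord0 k) y)
  = omega i y.
Proof.
move=> on ilen; set J := \matrix_(_, _) _.
have dJ l : (l <= n)%N -> dcoord l *m J
    = dcoord l + (odd l && (l < n)%N)%:R *: (r ord0 ord_max *: dcoord l.+1).
  move=> llen; rewrite -rowE; apply/rowP => q.
  rewrite !mxE left_translation_jacobian eqxx /= inordK//.
  rewrite -(val_eqE (inord l)) -(val_eqE q) /= inordK// [l == _]eq_sym.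
  congr (_ + _); have [/andP[_ ln]|_] := boolP (odd l && (l < n)%N); last by rewrite !mul0r.
  by rewrite -[q == inord _]val_eqE /= inordK// mul1r mulrC.
have on0 : (@ord_max n == ord0) = false.
  by apply/negbTE; rewrite -val_eqE /=; case: (n) on.
rewrite /omega; case: ifPn => [/andP[oi ltin]|oin]; last first.
  by rewrite dJ// (negbTE oin) scale0r addr0.
rewrite mulmxBl -scalemxAl !dJ// oi ltin /= oi /= scale0r scale1r addr0.
rewrite [left_translation _ _ _ _]mxE on0 /= ltnn andbF addr0 scalerDl opprD addrA.
by rewrite addrK.
Qed.

Let partial_frame (i : nat) (k j : 'I_n.+1) y : (0 < i <= n)%N ->
  partial k (fun z => frame i z ord0 j) y
  = (~~ odd i && (k == n :> nat) && (j == i.-1 :> nat))%:R.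
Proof.
move=> /andP[i0 ilen]; apply: affine_partial => s.
rewrite /frame; case: ifPn => oi /=; first by rewrite mulr0 addr0.
rewrite mxE [X in _ + X]mxE coord_line [in RHS]mxE [in X in _ = _ + X + _]mxE.
rewrite dcoordE ?dcoordE//; last by rewrite (leq_trans (leq_pred _)).
rewrite mulrDl addrA; congr (_ + _).
by rewrite -val_eqE /= eq_sym -mulrA -natrM mulnb.
Qed.

Lemma frame_bracket (j : 'I_n.-1) (y : 'rV[R]_n.+1) : odd n ->
  lie_bracket (frame n) (frame j.+1) y
  = \sum_(k < n.-1) blockJ k j *: frame k.+1 y.
Proof.
move=> on; have n0 : (0 < n)%N by case: (n) on.
have ltn1 (k : 'I_n.-1) : (k.+1 < n)%N by rewrite -ltn_predRL.
have len1 (k : 'I_n.-1) : (k.+1 <= n)%N by apply: ltnW.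
have pos_len1 (k : 'I_n.-1) : (0 < k.+1 <= n)%N by apply: len1.
have nn : (0 < n <= n)%N by rewrite n0 /=.
apply/rowP => q; rewrite mxE summxE (bigD1 ord_max)//= big1 => [|i imax].
  rewrite (partial_frame _ _ _ (pos_len1 j)) (partial_frame _ _ _ nn) /= on /= mulr0 subr0 addr0 eqxx /=.
  rewrite /frame on dcoordE// eqxx mul1r negbK.
  rewrite (eq_bigr (fun k : 'I_n.-1 =>
      (~~ odd k && (j == k.+1 :> nat) && (q == j :> nat))%:R)).
    have [oj|oj] := boolP (odd j); last first.
      rewrite big1 // => k _; case: eqP => [jk|]; last by rewrite andbF.
      by rewrite -[odd k]negbK -oddS -jk (negbTE oj).
    have j0 : (0 < j)%N by case: (val j) oj.
    have jl : (j.-1 < n.-1)%N by rewrite (leq_ltn_trans (leq_pred _)).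
    rewrite (bigD1 (Ordinal jl))//= big1 => [|k kj].
      by rewrite prednK// eqxx -oddS prednK// oj addr0.
    case: eqP => [jk|]; last by rewrite andbF.
    by case/negP: kj; rewrite -val_eqE /= jk.
  move=> k _; rewrite !mxE; case: (boolP (odd k)) => ok /=; first by rewrite mul0r.
  case: eqP => [jk|_] /=; last by rewrite mul0r.
  by rewrite mul1r ok dcoordE ?len1// -jk.
rewrite (partial_frame _ _ _ (pos_len1 j)) (partial_frame _ _ _ nn) /= on /= mulr0 subr0.
by rewrite /frame on dcoordE// -[n in _ == n]/(val (@ord_max n)) val_eqE (negbTE imax) mul0r.
Qed.

Lemma frame_commute (i j : 'I_n.-1) (y : 'rV[R]_n.+1) : odd n ->
  lie_bracket (frame i.+1) (frame j.+1) y = 0.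
Proof.
move=> on; have n0 : (0 < n)%N by case: (n) on.
have ltn1 (k : 'I_n.-1) : (k.+1 < n)%N by rewrite -ltn_predRL.
have len1 (k : 'I_n.-1) : (k.+1 <= n)%N by apply: ltnW.
have pos_len1 (k : 'I_n.-1) : (0 < k.+1 <= n)%N by apply: len1.
apply/rowP => q; rewrite !mxE big1 // => l _.
have fr0 (k : 'I_n.-1) : l = n :> nat -> frame k.+1 y ord0 l = 0.
  move=> ln; rewrite /frame; case: ifP => _.
    by rewrite dcoordE ?len1// ln gtn_eqF.
  rewrite !mxE -!val_eqE /= !inordK ?ln ?ltnS ?(ltnW (ltn1 k))//.
    by rewrite !gtn_eqF ?mulr0 ?addr0// (ltn_trans _ (ltn1 k)).
  by rewrite ltnW// ltnW.
rewrite (partial_frame _ _ _ (pos_len1 i)) (partial_frame _ _ _ (pos_len1 j)).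
have [ln|ln] := eqVneq (l : nat) n; first by rewrite !fr0// !mul0r subr0.
by rewrite !andbF !mulr0 subr0.
Qed.

End Model.

Arguments diag_metric {R} n N a y.

Section Solution.
Context {R : realType}.
Implicit Types (c h : nat -> R).

Definition cosh (x : R) : R := (expR x + expR (- x)) / 2.

Definition hmx (n : nat) h : 'M[R]_n := diag_mx (\row_i h i.+1).

Definition kconst (n : nat) c : R := c 0%N * c 1%N / (c 2%N * c n).

Definition vacuum_metric (n : nat) c h (y : 'rV[R]_n.+1) : 'M[R]_n.+1 :=
  let t := y ord0 ord0 in
  let k := kconst n c in
  let m := n.-1./2 in
  cosh (k * t) ^+ m *:
    (- (c 0%N ^+ 2 * expR (2 * \tr (hmx n h) * t)) *: sq (dcoord n 0)
     + (c n ^+ 2 * expR (2 * h n * t)) *: sq (omega n y))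
  + \sum_(1 <= p < m.+1)
      ((c p.*2.-1 ^+ 2 * expR (2 * h p.*2.-1 * t) / cosh (k * t))
         *: sq (omega p.*2.-1 y)
       + (c p.*2 ^+ 2 * expR (2 * h p.*2 * t) * cosh (k * t))
         *: sq (omega p.*2 y)).

Definition vacuum_constants (n : nat) c h : Prop :=
  [/\ forall i, (i <= n)%N -> 0 < c i,
      forall p, (1 <= p <= n.-1./2)%N -> c p.*2.-1 / c p.*2 = c 1%N / c 2%N
    & \tr (hmx n h) ^+ 2 - \tr (hmx n h *m hmx n h)
      = (n.-1)%:R / 4 * kconst n c ^+ 2].

(* In the time coordinate of [vacuum_metric], N^2 a_{2p-1}^2/(a_{2p} a_n)^2
   equals k^2 e^(2 b t) / cosh^2(k t) with
   b = h_{2p-1} - h_{2p} - h_n + tr h, whereas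
   (ln a_{2p-1})'' = - k^2 / (2 cosh^2(k t)); the field equation along X_{2p-1}
   equates the latter with -1/2 times the former, which forces b = 0. *)
Definition exponent_balance (n : nat) h : Prop :=
  forall p, (1 <= p <= n.-1./2)%N ->
    h p.*2.-1 + \tr (hmx n h) = h p.*2 + h n.

Definition twice_derivable_on (I : set R) (f : R -> R) : Prop :=
  forall t, I t -> derivable f t 1 /\ derivable (derive1 f) t 1.

Definition positive_on (I : set R) (f : R -> R) : Prop :=
  forall t, I t -> 0 < f t.

End Solution.

Arguments vacuum_metric {R} n c h y.

(* Main.v *)
Require Import Defs.
From HB Require Import structures.
From mathcomp Require Import all_boot all_order all_algebra.
From mathcomp Require Import all_classical all_reals all_analysis.
From mathcomp Require Import ring zify.

Set Implicit Arguments.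
Unset Strict Implicit.
Unset Printing Implicit Defensive.

Import Order.TTheory GRing.Theory Num.Theory.
Import numFieldNormedType.Exports.

Local Open Scope classical_set_scope.
Local Open Scope ring_scope.

(** In the coordinates (t, x_1, ..., x_n) the metric depends on t and z = x_n
    only, and its part in x_1, ..., x_(n-1) splits into 2 x 2 blocks
    S(z)^T diag(f_(2p-1), f_(2p)) S(z), where f_i = a_i^2 and S is unipotent.
    Hence the Christoffel symbols are block diagonal and explicit, and the Ricci
    tensor vanishes iff, with L_i = a_i'/a_i (L_0 = N'/N),
    theta = L_1 + ... + L_n and twist_p = (N a_(2p-1) / (a_(2p) a_n))^2,
      L_i' + L_i (theta - L_0) = eps_i twist / 2
    (eps_i = -1 for i = 2p-1, 1 for i = 2p, and the sum of the twists for i = n)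
    together with one constraint.

    For the explicit metric theta = L_0, and each equation along X_(2p-1) says
    exp (2 b_p t) = 1.  Conversely, if all twists agree, let tau be the time with
    dtau/dt = N / (a_1 ... a_n).  Then w = ln (twist / (dtau/dt)^2) satisfies
    d^2 w / dtau^2 = - 2 exp w, whose energy (dw/dtau)^2 + 4 exp w = 4 k^2 is
    conserved.  So tanh (k tau) = - (dw/dtau) / (2 k) up to translation, which
    gives tau in closed form without integrating, and every
    ln a_i + eps_i w / 4 (eps_n = (n-1)/2) is affine in tau. *)

(** * Derivative rules for real functions written pointwise *)

Section Calculus.
Context {R : realType}.
Implicit Types (f g : R -> R) (t df dg : R).

Local Notation "f '`is' df '`at' t" := (is_derive t (1 : R) f df) (at level 60).

Lemma is_derive1_cst (a t : R) : (fun=> a) `is 0 `at t.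
Proof. exact: is_derive_cst. Qed.

Lemma is_derive1_id t : (fun x => x) `is 1 `at t.
Proof. exact: is_derive_id. Qed.

Lemma is_derive1D f g t df dg : f `is df `at t -> g `is dg `at t ->
  (fun x => f x + g x) `is (df + dg) `at t.
Proof. by move=> fd gd; exact: is_deriveD. Qed.

Lemma is_derive1N f t df : f `is df `at t -> (fun x => - f x) `is (- df) `at t.
Proof. by move=> fd; exact: is_deriveN. Qed.

Lemma is_derive1M f g t df dg : f `is df `at t -> g `is dg `at t ->
  (fun x => f x * g x) `is (df * g t + f t * dg) `at t.
Proof.
move=> fd gd; have h := is_deriveM fd gd.
apply: (is_derive_eq (f := fun x => f x * g x) h).
by rewrite /GRing.scale /= addrC [g t * _]mulrC.
Qed.

Lemma is_derive1X f n t df : f `is df `at t ->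
  (fun x => f x ^+ n) `is (n%:R * f t ^+ n.-1 * df) `at t.
Proof.
move=> fd; have h := is_deriveX n fd.
rewrite (_ : (fun _ => _) = f ^+ n); first exact: h.
by apply/funext => x; rewrite exprfctE.
Qed.

Lemma is_derive1V f t df : f t != 0 -> f `is df `at t ->
  (fun x => (f x)^-1) `is (- (f t ^- 2 * df)) `at t.
Proof.
move=> f0 fd; apply: (is_derive_eq (is_deriveV f0 fd)).
by rewrite /GRing.scale /= mulNr.
Qed.

Lemma is_derive1_sum (J : Type) (r : seq J) (P : pred J) (f : J -> R -> R)
    (df : J -> R) t :
  (forall j, P j -> f j `is df j `at t) ->
  (fun x => \sum_(j <- r | P j) f j x) `is (\sum_(j <- r | P j) df j) `at t.
Proof.
move=> fd; elim: r => [|j r IH].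
  rewrite big_nil (_ : (fun _ => _) = cst 0); first exact: is_derive1_cst.
  by apply/funext => x; rewrite big_nil.
rewrite big_cons; under eq_fun do rewrite big_cons.
by case: ifPn => // Pj; apply: is_derive1D => //; exact: fd.
Qed.

Lemma is_derive1_chain f g t df dg : f `is df `at (g t) -> g `is dg `at t ->
  (fun x => f (g x)) `is (dg * df) `at t.
Proof.
by move=> fd gd; rewrite mulrC; exact: is_derive1_comp.
Qed.

Lemma is_derive1_expRf f t df : f `is df `at t ->
  (fun x => expR (f x)) `is (df * expR (f t)) `at t.
Proof. by move=> fd; apply: is_derive1_chain => //; exact: is_derive_expR. Qed.

Lemma is_derive1_lnf f t df : 0 < f t -> f `is df `at t ->
  (fun x => ln (f x)) `is (df / f t) `at t.
Proof. by move=> f0 fd; apply: is_derive1_chain => //; exact: is_derive1_ln. Qed.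

Lemma derive1_val f t df : f `is df `at t -> derive1 f t = df.
Proof. by move=> fd; rewrite derive1E; exact: derive_val. Qed.

Lemma derive1P f t : derivable f t 1 -> f `is (derive1 f t) `at t.
Proof. by move=> fd; rewrite derive1E; exact: derivableP. Qed.

Lemma open_near (I : set R) t : open I -> I t -> \near t, I t.
Proof. by move=> I_open It; exact: open_nbhs_nbhs. Qed.

(** By the mean value theorem on the segment joining the two points, which lies in the interval [I].
    All conservation laws below go through this lemma. *)
Lemma is_derive1_0_cst (I : set R) f : is_interval I ->
  (forall t, I t -> f `is 0 `at t) -> forall s t, I s -> I t -> f s = f t.
Proof.
move=> I_itv fd; suff H s t : s <= t -> I s -> I t -> f s = f t.
  by move=> s t Is It; case: (leP s t) => [/H|/ltW /H H']; [exact|rewrite H'].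
move=> st Is It.
have Iu u : u \in `[s, t] -> I u by rewrite in_itv => ut; exact: (I_itv s t).
have [u _ e] : exists2 u, u \in `[s, t]%R & f t - f s = 0 * (t - s).
  apply: (@MVT_segment _ f (fun=> 0)) => // [u uI|].
    by apply/fd/Iu; exact: subset_itv_oo_cc uI.
  apply: derivable_within_continuous => u /Iu/fd fdu.
  exact: ex_derive.
by apply/esym/eqP; rewrite -subr_eq0 e mul0r.
Qed.

End Calculus.

(** * Finite sums regrouped by 2 x 2 blocks *)

Section BlockSums.
Context {R : pzRingType}.

Lemma sum_double m (F : nat -> R) :
  \sum_(0 <= i < m.*2) F i = \sum_(p < m) (F p.*2 + F p.*2.+1).
Proof.
elim: m => [|m IH]; first by rewrite big_nil big_ord0.
by rewrite doubleS !big_nat_recr//= IH big_ord_recr /= addrA.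
Qed.

Lemma sum_odd_even m (F : nat -> R) :
  \sum_(1 <= i < m.*2.+2) F i
  = \sum_(p < m) (F p.*2.+1 + F p.*2.+2) + F m.*2.+1.
Proof.
by rewrite big_nat_recr//= big_add1/= (sum_double m (fun i => F i.+1)).
Qed.

Lemma sum_ord_blocks m (F : 'I_m.*2.+2 -> R) :
  \sum_k F k = F ord0 + F ord_max
    + \sum_(p < m) (F (inord p.*2.+1) + F (inord p.*2.+2)).
Proof.
have -> : \sum_k F k = \sum_(0 <= k < m.*2.+2) F (inord k).
  by rewrite big_mkord; apply: eq_bigr => k _; rewrite inord_val.
rewrite big_ltn// (sum_odd_even m (F \o inord)) /=.
rewrite (_ : inord 0 = ord0); last by apply: val_inj; rewrite /= inordK.
rewrite (_ : inord m.*2.+1 = ord_max); last by apply: val_inj; rewrite /= inordK.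
by rewrite [X in _ + X]addrC addrA.
Qed.

Lemma sum_delta m (p : 'I_m) (F : 'I_m -> R) :
  \sum_q (p == q)%:R * F q = F p.
Proof.
rewrite (bigD1 p)//= eqxx mul1r big1 ?addr0// => q qp.
by rewrite eq_sym (negbTE qp) mul0r.
Qed.

End BlockSums.

(** * Coordinates adapted to the blocks *)

(** Case analysis on a slot replaces parity arithmetic on indices. With blocks counted from 0,
    [fib p false] and [fib p true] stand for x_(2p+1) and x_(2p+2), [base] for x_n, and n = 2m +
    1. *)
Inductive slot m := time | base | fib of 'I_m & bool.
Arguments time {m}.
Arguments base {m}.
Arguments fib {m} p b.

Definition slot_ord m (x : slot m) : 'I_m.*2.+2 :=
  match x with
  | time => ord0
  | base => ord_max
  | fib p b => inord (if b then p.*2.+2 else p.*2.+1)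
  end.

(** A Kronecker delta that computes by cases, so that simplification settles every comparison except
    that of two block numbers. *)
Definition slot_delta {R : pzRingType} m (x y : slot m) : R :=
  match x, y with
  | time, time | base, base => 1
  | fib p b, fib q c => (p == q)%:R * (b == c)%:R
  | _, _ => 0
  end.

Section Slots.
Variable m : nat.
Implicit Types (x y : slot m) (p q : 'I_m).

Lemma val_slot_ord x : slot_ord x = match x with
  | time => 0 | base => m.*2.+1 | fib p b => if b then p.*2.+2 else p.*2.+1
  end%N :> nat.
Proof.
case: x => //= p b; rewrite inordK//.
by have := ltn_ord p; case: b; lia.
Qed.

Lemma slot_ord_inj : injective (@slot_ord m).
Proof.
move=> x y /(congr1 val); rewrite /= !val_slot_ord.
case: x y => [||p b] [||q c] //=; try (case: c; try have := ltn_ord q; lia);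
  try (case: b; try have := ltn_ord p; lia).
by move=> e; have [-> ->] : p = q /\ b = c by
  case: b c e => -[] e; split => //; try (apply: val_inj => /=); lia.
Qed.

Lemma slot_ord_surj (i : 'I_m.*2.+2) : exists x, i = slot_ord x.
Proof.
have [->|i0] := eqVneq i ord0; first by exists time.
have [->|im] := eqVneq i ord_max; first by exists base.
have iV : (i = odd i + i./2.*2 :> nat)%N by rewrite odd_double_half.
move: i0 im; rewrite -!val_eqE /= => i0 im.
have il := ltn_ord i.
case oi : (odd i) in iV.
  have pm : (i./2 < m)%N by lia.
  by exists (fib (Ordinal pm) false); apply: val_inj; rewrite [RHS]val_slot_ord /=.
have pm : (i./2.-1 < m)%N by lia.
exists (fib (Ordinal pm) true); apply: val_inj; rewrite [RHS]val_slot_ord /=.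
lia.
Qed.

Definition ord_slot (i : 'I_m.*2.+2) : slot m := sval (cid (slot_ord_surj i)).

Lemma ord_slotK : cancel ord_slot (@slot_ord m).
Proof. by move=> i; rewrite /ord_slot; case: cid. Qed.

Lemma slot_ordK : cancel (@slot_ord m) ord_slot.
Proof. by move=> x; apply: slot_ord_inj; rewrite ord_slotK. Qed.

Lemma slot_deltaE (R : pzRingType) x y :
  (slot_ord x == slot_ord y)%:R = slot_delta x y :> R.
Proof.
case: eqP => [/slot_ord_inj <-|xy].
  by case: x => //= p b; rewrite !eqxx mulr1.
case: x y xy => [||p b] [||q c] //= xy; case: eqP => pq; rewrite ?mul0r//.
by case: eqP => bc; rewrite ?mulr0//; case: xy; rewrite pq bc.
Qed.

Lemma sum_slots (R : pzRingType) (F : 'I_m.*2.+2 -> R) :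
  \sum_k F k = F (slot_ord time) + F (slot_ord base)
    + \sum_p (F (slot_ord (fib p false)) + F (slot_ord (fib p true))).
Proof. exact: sum_ord_blocks. Qed.

End Slots.

(** * Partial derivatives of functions of t and x_n *)

Section Partial.
Context {R : realType}.
Variable m : nat.
Notation n := m.*2.+1.

Lemma derive_along_line (V : normedModType R) (phi : V -> R) (G : R -> R)
    (y v : V) (s0 : R) :
  (forall s, phi (s *: v + y) = G (s + s0)) -> 'D_v phi y = 'D_1 G s0.
Proof.
move=> phiE; have phi0 : phi y = G s0 by rewrite -[y]add0r -(scale0r v) phiE add0r.
rewrite /derive (_ : (fun h : R => _) =
  (fun h : R => h^-1 *: ((G \o shift s0) (h *: (1 : R)) - G s0)))//.
by apply/funext => h /=; rewrite phiE phi0 /shift [_ *: 1]mulr1.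
Qed.

(** Since [I] is open, [phi] agrees with [F] near [y], which is all a derivative sees. Along a
    coordinate line [F] then depends on one real variable, or on none in a fibre direction. *)
Lemma partial_slot (I : set R) (phi : 'rV[R]_n.+1 -> R) (F : R -> R -> R)
    (x : slot m) (y : 'rV[R]_n.+1) (dt dz : R) :
  open I -> I (y ord0 ord0) ->
  (forall y' : 'rV[R]_n.+1, I (y' ord0 ord0) ->
     phi y' = F (y' ord0 ord0) (y' ord0 ord_max)) ->
  is_derive (y ord0 ord0) (1 : R) (F ^~ (y ord0 ord_max)) dt ->
  is_derive (y ord0 ord_max) (1 : R) (F (y ord0 ord0)) dz ->
  partial (slot_ord x) phi y
  = match x with time => dt | base => dz | fib _ _ => 0 end.
Proof.
move=> I_open Iy phiE Ft Fz.
have -> : partial (slot_ord x) phi y = partial (slot_ord x)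
    (fun y' : 'rV[R]_n.+1 => F (y' ord0 ord0) (y' ord0 ord_max)) y.
  apply: near_eq_derive.
  suff : \forall y' \near y, I ((y' : 'rV[R]_n.+1) ord0 ord0) by apply: filterS => y' /phiE.
  by apply: (@coord_continuous R 1 n.+1 ord0 ord0 y); exact: open_near.
have lineE s (j : 'I_n.+1) :
    (s *: delta_mx ord0 (slot_ord x) + y) ord0 j
    = s * (j == slot_ord x)%:R + y ord0 j by rewrite !mxE eqxx.
have deltaE : ((ord0 == slot_ord x)%:R = slot_delta time x :> R)
  * ((ord_max == slot_ord x)%:R = slot_delta base x :> R).
  by split; rewrite -slot_deltaE.
rewrite /partial; case: x lineE deltaE => [||p b] lineE deltaE /=.
- have <- := @derive_val _ _ _ _ _ _ _ Ft; apply: derive_along_line => s.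
  by rewrite !lineE !deltaE //= mulr1 mulr0 add0r.
- have <- := @derive_val _ _ _ _ _ _ _ Fz; apply: derive_along_line => s.
  by rewrite !lineE !deltaE //= mulr1 mulr0 add0r.
- have <- : 'D_1 (cst (F (y ord0 ord0) (y ord0 ord_max)) : R -> R) (0 : R) = 0.
    exact: derive_val.
  apply: derive_along_line => s.
  by rewrite !lineE !deltaE //= !mulr0 !add0r.
Qed.

End Partial.

(** * The metric and its inverse in the coordinate frame *)

Section DiagonalSquares.
Context {R : realType}.
Variable m : nat.
Notation n := m.*2.+1.
Implicit Types (x : slot m) (p q : 'I_m) (y : 'rV[R]_n.+1).

Lemma sqE (w : 'rV[R]_n.+1) i j : sq w i j = w ord0 i * w ord0 j.
Proof. by rewrite mxE big_ord1 mxE. Qed.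

Lemma dcoordE (i : nat) (j : 'I_n.+1) : (i <= n)%N ->
  dcoord n i ord0 j = (j == i :> nat)%:R :> R.
Proof. by move=> ilen; rewrite mxE eqxx -val_eqE /= inordK. Qed.

Lemma dcoord_slot x x' :
  dcoord n (slot_ord x) ord0 (slot_ord x') = slot_delta x' x :> R.
Proof.
by rewrite dcoordE; [rewrite -slot_deltaE -val_eqE|rewrite -ltnS ltn_ord].
Qed.

Lemma omega_odd p x y : omega p.*2.+1 y ord0 (slot_ord x)
  = match x with
    | fib q b => (p == q)%:R * (if b then - y ord0 ord_max else 1)
    | _ => 0
    end.
Proof.
have pm := ltn_ord p.
rewrite /omega /= odd_double /= ifT; last by lia.
rewrite [LHS]mxE [X in _ + X]mxE [X in _ - X]mxE.
have -> : dcoord n p.*2.+1 = dcoord n (slot_ord (fib p false)) by rewrite val_slot_ord.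
have -> : dcoord n p.*2.+2 = dcoord n (slot_ord (fib p true)) by rewrite val_slot_ord.
rewrite !dcoord_slot; case: x => [||q b] /=; rewrite ?mulr0 ?subr0//.
by rewrite eq_sym; case: b => /=; ring.
Qed.

Lemma omega_even p x y : omega p.*2.+2 y ord0 (slot_ord x)
  = match x with fib q b => (p == q)%:R * b%:R | _ => 0 end.
Proof.
rewrite /omega /= odd_double /=.
have -> : dcoord n p.*2.+2 = dcoord n (slot_ord (fib p true)) by rewrite val_slot_ord.
by rewrite dcoord_slot; case: x => [||q b] //=; rewrite eq_sym eqb_id.
Qed.

Lemma omega_base x y : omega n y ord0 (slot_ord x) = slot_delta x base.
Proof.
rewrite /omega ltnn andbF -dcoord_slot.
by congr (dcoord _ _ _ _); rewrite val_slot_ord.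
Qed.

(** Index 0 carries the squared lapse. Both the general diagonal metric and the explicit solution
    are instances, so the curvature is computed only once. *)
Definition squares_metric (f : nat -> R -> R) y : 'M[R]_n.+1 :=
  let t := y ord0 ord0 in
  (- f 0%N t) *: sq (dcoord n 0)
  + \sum_(1 <= i < n.+1) f i t *: sq (omega i y).

Section Components.
Variables (f : nat -> R -> R) (t z : R).

(** This is S^T diag(f_(2p+1), f_(2p+2)) S, where S has rows (1, -z) and (0, 1), the coefficients of
    the two left-invariant forms. *)
Definition met_block p (b c : bool) : R :=
  match b, c with
  | false, false => f p.*2.+1 t
  | true, true => f p.*2.+2 t + z ^+ 2 * f p.*2.+1 t
  | _, _ => - (z * f p.*2.+1 t)
  end.

Definition met x x' : R :=
  match x, x' with
  | time, time => - f 0%N t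
  | base, base => f n t
  | fib p b, fib q c => (p == q)%:R * met_block p b c
  | _, _ => 0
  end.

(** Inverse of the previous block, using that S^-1 has rows (1, z) and (0, 1). *)
Definition inv_block p (b c : bool) : R :=
  match b, c with
  | false, false => (f p.*2.+1 t)^-1 + z ^+ 2 * (f p.*2.+2 t)^-1
  | true, true => (f p.*2.+2 t)^-1
  | _, _ => z * (f p.*2.+2 t)^-1
  end.

Definition inv_met x x' : R :=
  match x, x' with
  | time, time => - (f 0%N t)^-1
  | base, base => (f n t)^-1
  | fib p b, fib q c => (p == q)%:R * inv_block p b c
  | _, _ => 0
  end.

End Components.

Lemma squares_metricE f y x x' :
  squares_metric f y (slot_ord x) (slot_ord x')
  = met f (y ord0 ord0) (y ord0 ord_max) x x'.
Proof.
rewrite /squares_metric; set t := y ord0 ord0; set z := y ord0 ord_max.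
rewrite mxE [X in X + _]mxE sqE summxE.
under eq_bigr do rewrite mxE sqE.
rewrite (sum_odd_even m (fun i => f i t *
  (omega i y ord0 (slot_ord x) * omega i y ord0 (slot_ord x')))).
under eq_bigr do rewrite !omega_odd !omega_even.
rewrite !omega_base.
have -> : dcoord n 0 = dcoord n (slot_ord (@time m)) by [].
rewrite !dcoord_slot.
case: x x' => [||q b] [||q' b'] /=;
  rewrite ?(mulr0, mul0r, mulr1, mul1r, addr0, add0r);
  try by rewrite big1 ?addr0 ?add0r// => p _; rewrite !(mulr0, mul0r) addr0.
rewrite (eq_bigr (fun p => (q == p)%:R * ((p == q')%:R *
  met_block f t z p b b'))); first exact: sum_delta.
move=> p _; rewrite [p == q]eq_sym -/z.
by case: b b' => -[] /=; ring.
Qed.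

(** The left side is a contraction in the shape produced by [sum_slots]; block diagonality leaves at
    most two of its terms. *)
Lemma sum_inv_met f t z x (X : slot m -> R) :
  inv_met f t z x time * X time + inv_met f t z x base * X base
  + \sum_p (inv_met f t z x (fib p false) * X (fib p false)
            + inv_met f t z x (fib p true) * X (fib p true))
  = match x with
    | time => - (f 0%N t)^-1 * X time
    | base => (f n t)^-1 * X base
    | fib p b => inv_block f t z p b false * X (fib p false)
                 + inv_block f t z p b true * X (fib p true)
    end.
Proof.
case: x => [||p b] /=; rewrite ?mul0r ?add0r ?addr0.
- by rewrite big1 ?addr0// => p _; rewrite !mul0r addr0.
- by rewrite big1 ?addr0// => p _; rewrite !mul0r addr0.
- rewrite -[RHS](sum_delta p (fun q => inv_block f t z q b false * X (fib q false)
                 + inv_block f t z q b true * X (fib q true))).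
  apply: eq_bigr => q _.
  case: (eqVneq p q) => [->|_]; last by rewrite !mul0r addr0.
  by rewrite !mul1r.
Qed.

Lemma invmx_squares_metric f y x x' :
  (forall i, (i <= n)%N -> f i (y ord0 ord0) != 0) ->
  invmx (squares_metric f y) (slot_ord x) (slot_ord x')
  = inv_met f (y ord0 ord0) (y ord0 ord_max) x x'.
Proof.
set t := y ord0 ord0; set z := y ord0 ord_max => f0.
pose H : 'M[R]_n.+1 :=
  \matrix_(i, j) inv_met f t z (ord_slot i) (ord_slot j).
have HE u v : H (slot_ord u) (slot_ord v) = inv_met f t z u v.
  by rewrite mxE !slot_ordK.
(* A left inverse of a square matrix is its inverse, so one product identity suffices. *)
suff e : H *m squares_metric f y = 1%:M.
  have gH := mulmx1C e; have [gu _] := mulmx1_unit gH.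
  by rewrite -[invmx _]mul1mx -e -mulmxA mulmxV// mulmx1 HE.
apply/matrixP => i j.
have [u ->] := slot_ord_surj i; have [v ->] := slot_ord_surj j.
rewrite mxE sum_slots; under eq_bigr do rewrite !HE !squares_metricE.
rewrite !HE !squares_metricE (sum_inv_met f t z u (fun w => met f t z w v)).
rewrite mxE slot_deltaE.
have fb : f n t != 0 by exact: f0.
have ft : f 0%N t != 0 by exact: f0.
case: u v => [||p b] [||q c] /=; rewrite ?mulr0 ?addr0//.
- by rewrite mulrNN mulVf.
- by rewrite mulVf.
- have pm := ltn_ord p.
  have fo : f p.*2.+1 t != 0 by apply: f0; lia.
  have fe : f p.*2.+2 t != 0 by apply: f0; lia.
  case: (eqVneq p q) => _; last by rewrite !mul0r !mulr0 addr0.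
  rewrite -/z -/t.
  by case: b c => -[] /=; rewrite ?mul1r; field; rewrite ?fo ?fe.
Qed.

End DiagonalSquares.

(** * Christoffel symbols and the Ricci tensor *)

(** For f_i = a_i^2 this makes L_i = a_i'/a_i and D_i = L_i'. All derivatives needed for the
    curvature become rational in [f], [L], [D], so [field] can decide the component identities. *)
Definition log_derivatives {R : realType} (N : nat) (I : set R)
    (f L D : nat -> R -> R) : Prop :=
  forall i t, (i <= N)%N -> I t ->
    [/\ f i t != 0, is_derive t (1 : R) (f i) (2 * L i t * f i t)
      & is_derive t (1 : R) (L i) (D i t)].

Section Ricci.
Context {R : realType}.
Variable m : nat.
Notation n := m.*2.+1.
Implicit Types (x : slot m) (p q : 'I_m) (y : 'rV[R]_n.+1).

Section Symbols.
Variables (f L D : nat -> R -> R) (t z : R).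
Notation fo p := (f (p : 'I_m).*2.+1 t).
Notation fe p := (f (p : 'I_m).*2.+2 t).
Notation Lo p := (L (p : 'I_m).*2.+1 t).
Notation Le p := (L (p : 'I_m).*2.+2 t).
Notation Do p := (D (p : 'I_m).*2.+1 t).
Notation De p := (D (p : 'I_m).*2.+2 t).

(* For a fibre block gamma of the metric: gamma_t / 2, gamma_z / 2,
   gamma^-1 gamma_t / 2 and gamma^-1 gamma_z / 2. *)
Definition half_dt p (b c : bool) : R :=
  match b, c with
  | false, false => Lo p * fo p
  | true, true => Le p * fe p + z ^+ 2 * (Lo p * fo p)
  | _, _ => - (z * (Lo p * fo p))
  end.

Definition half_dz p (b c : bool) : R :=
  match b, c with
  | false, false => 0
  | true, true => z * fo p
  | _, _ => - (fo p / 2)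
  end.

Definition log_dt p (b c : bool) : R :=
  match b, c with
  | false, false => Lo p
  | false, true => z * (Le p - Lo p)
  | true, false => 0
  | true, true => Le p
  end.

Definition log_dz p (b c : bool) : R :=
  match b, c with
  | false, false => - (z * (fo p * (fe p)^-1) / 2)
  | false, true => (z ^+ 2 * (fo p * (fe p)^-1) - 1) / 2
  | true, false => - (fo p * (fe p)^-1 / 2)
  | true, true => z * (fo p * (fe p)^-1) / 2
  end.

(** The table of Gamma^k_{ij}, upper index first, justified by [christoffelE]. Explicit entries can
    be differentiated one at a time. *)
Definition chr (k i j : slot m) : R :=
  match k, i, j with
  | time, time, time => L 0 t
  | time, base, base => f n t * L n t * (f 0 t)^-1
  | time, fib p b, fib q c => (p == q)%:R * (half_dt p b c * (f 0 t)^-1)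
  | base, time, base | base, base, time => L n t
  | base, fib p b, fib q c => (p == q)%:R * - (half_dz p b c * (f n t)^-1)
  | fib p b, time, fib q c | fib p b, fib q c, time => (p == q)%:R * log_dt p b c
  | fib p b, base, fib q c | fib p b, fib q c, base => (p == q)%:R * log_dz p b c
  | _, _, _ => 0
  end.

Definition met_d x (i j : slot m) : R :=
  match x, i, j with
  | time, time, time => - (2 * L 0 t * f 0 t)
  | time, base, base => 2 * L n t * f n t
  | time, fib p b, fib q c => (p == q)%:R * (2 * half_dt p b c)
  | base, fib p b, fib q c => (p == q)%:R * (2 * half_dz p b c)
  | _, _, _ => 0
  end.

Definition half_dt_dt p (b c : bool) : R :=
  match b, c with
  | false, false => (Do p + 2 * Lo p ^+ 2) * fo p
  | true, true => (De p + 2 * Le p ^+ 2) * fe p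
                  + z ^+ 2 * ((Do p + 2 * Lo p ^+ 2) * fo p)
  | _, _ => - (z * ((Do p + 2 * Lo p ^+ 2) * fo p))
  end.

(** In [log_dz] only the quotient r = f_(2p+1)/f_(2p+2) depends on t, with r' = 2 (L_(2p+1) -
    L_(2p+2)) r. Adding 1/2 in the upper right entry removes the part of [log_dz] free of r. *)
Definition chr_dt (k i j : slot m) : R :=
  match k, i, j with
  | time, time, time => D 0 t
  | time, base, base =>
      f n t * (D n t + 2 * L n t * (L n t - L 0 t)) * (f 0 t)^-1
  | time, fib p b, fib q c =>
      (p == q)%:R * ((half_dt_dt p b c - 2 * L 0 t * half_dt p b c) * (f 0 t)^-1)
  | base, time, base | base, base, time => D n t
  | base, fib p b, fib q c =>
      (p == q)%:R * - (((if b && c then 2 * z * Lo p * fo p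
                         else if b || c then - (Lo p * fo p) else 0)
                        - 2 * L n t * half_dz p b c) * (f n t)^-1)
  | fib p b, time, fib q c | fib p b, fib q c, time =>
      (p == q)%:R * match b, c with
                    | false, false => Do p
                    | false, true => z * (De p - Do p)
                    | true, false => 0
                    | true, true => De p
                    end
  | fib p b, base, fib q c | fib p b, fib q c, base =>
      (p == q)%:R * (2 * (Lo p - Le p) *
                     (log_dz p b c + (if ~~ b && c then 2^-1 else 0)))
  | _, _, _ => 0
  end.

Definition chr_dz (k i j : slot m) : R :=
  match k, i, j with
  | time, fib p b, fib q c =>
      (p == q)%:R * ((if b && c then 2 * z * (Lo p * fo p)
                      else if b || c then - (Lo p * fo p) else 0) * (f 0 t)^-1)
  | base, fib p b, fib q c =>
      (p == q)%:R * - ((if b && c then fo p else 0) * (f n t)^-1)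
  | fib p b, time, fib q c | fib p b, fib q c, time =>
      (p == q)%:R * (if ~~ b && c then Le p - Lo p else 0)
  | fib p b, base, fib q c | fib p b, fib q c, base =>
      (p == q)%:R * match b, c with
                    | false, false => - (fo p * (fe p)^-1 / 2)
                    | false, true => z * (fo p * (fe p)^-1)
                    | true, false => 0
                    | true, true => fo p * (fe p)^-1 / 2
                    end
  | _, _, _ => 0
  end.

Definition expansion : R := L n t + \sum_(p < m) (Lo p + Le p).

Definition expansion_dt : R := D n t + \sum_(p < m) (Do p + De p).

Definition ric_odd p : R :=
  fo p / f 0 t * (Do p + Lo p * (expansion - L 0 t))
  + fo p ^+ 2 / (fe p * f n t) / 2.

Definition ric_even p : R :=
  fe p / f 0 t * (De p + Le p * (expansion - L 0 t)) - fo p / f n t / 2.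

(** In the left-invariant frame the fibre block is diag([ric_odd], [ric_even]). The powers of z come
    only from S, exactly as in [met_block]. *)
Definition ric (i j : slot m) : R :=
  match i, j with
  | time, time => - expansion_dt + expansion * L 0 t - L n t ^+ 2
                  - \sum_(p < m) (Lo p ^+ 2 + Le p ^+ 2)
  | base, base => f n t / f 0 t * (D n t + L n t * (expansion - L 0 t))
                  - \sum_(p < m) (fo p / fe p) / 2
  | fib p b, fib q c => (p == q)%:R *
      match b, c with
      | false, false => ric_odd p
      | true, true => ric_even p + z ^+ 2 * ric_odd p
      | _, _ => - (z * ric_odd p)
      end
  | _, _ => 0
  end.

(** With the upper and one lower index fixed, at most two entries of the table are nonzero, so
    contractions lose their sum over blocks. *)
Lemma sum_chr k j (X : slot m -> R) :
  chr k j time * X time + chr k j base * X base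
  + \sum_p (chr k j (fib p false) * X (fib p false)
            + chr k j (fib p true) * X (fib p true))
  = match k, j with
    | time, time => L 0 t * X time
    | time, base => f n t * L n t * (f 0 t)^-1 * X base
    | time, fib p b => half_dt p b false * (f 0 t)^-1 * X (fib p false)
                       + half_dt p b true * (f 0 t)^-1 * X (fib p true)
    | base, time => L n t * X base
    | base, base => L n t * X time
    | base, fib p b => - (half_dz p b false * (f n t)^-1 * X (fib p false)
                       + half_dz p b true * (f n t)^-1 * X (fib p true))
    | fib p b, time => log_dt p b false * X (fib p false)
                       + log_dt p b true * X (fib p true)
    | fib p b, base => log_dz p b false * X (fib p false)
                       + log_dz p b true * X (fib p true)
    | fib p b, fib q c => (p == q)%:R * (log_dt p b c * X time
                                         + log_dz p b c * X base)
    end.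
Proof.
have S0 (F : 'I_m -> R) : (forall p, F p = 0) -> \sum_p F p = 0.
  by move=> F0; rewrite big1.
have SD p (F G : 'I_m -> R) : (forall q, F q = (p == q)%:R * G q) ->
    \sum_q F q = G p.
  by move=> FG; rewrite -(sum_delta p G); apply: eq_bigr.
case: k j => [||p b] [||q c] /=;
  (rewrite S0; last by move=> r; ring) || idtac; try ring.
- rewrite (SD q _ (fun q => half_dt q c false * (f 0 t)^-1 * X (fib q false)
    + half_dt q c true * (f 0 t)^-1 * X (fib q true))); first ring.
  by move=> r; case: eqVneq => [->|_] /=; ring.
- rewrite (SD q _ (fun q => - (half_dz q c false * (f n t)^-1 * X (fib q false)
    + half_dz q c true * (f n t)^-1 * X (fib q true)))); first ring.
  by move=> r; case: eqVneq => [->|_] /=; ring.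
- rewrite (SD p _ (fun p => log_dt p b false * X (fib p false)
    + log_dt p b true * X (fib p true))); first ring.
  by move=> r; case: eqVneq => [->|_] /=; ring.
- rewrite (SD p _ (fun p => log_dz p b false * X (fib p false)
    + log_dz p b true * X (fib p true))); first ring.
  by move=> r; case: eqVneq => [->|_] /=; ring.
Qed.

End Symbols.

Section Derivatives.
Variables (I : set R) (f L D : nat -> R -> R).
Hypothesis fLD : log_derivatives n I f L D.

Let deriv_f i t : (i <= n)%N -> I t ->
  is_derive t (1 : R) (f i) (2 * L i t * f i t).
Proof. by move=> ilen It; case: (fLD ilen It). Qed.

Let deriv_L i t : (i <= n)%N -> I t -> is_derive t (1 : R) (L i) (D i t).
Proof. by move=> ilen It; case: (fLD ilen It). Qed.

Let deriv_fV i t : (i <= n)%N -> I t ->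
  is_derive t (1 : R) (fun t => (f i t)^-1) (- (2 * L i t * (f i t)^-1)).
Proof.
move=> ilen It; have [f0 fd _] := fLD ilen It.
by apply: (is_derive_eq (is_derive1V f0 fd)); field.
Qed.

Let f_neq0 i t : (i <= n)%N -> I t -> f i t != 0.
Proof. by move=> ilen It; case: (fLD ilen It). Qed.

Ltac component_field := field; repeat (apply/andP; split);
  first [by [] | apply: f_neq0 => //; lia].

Ltac derive_step := first
  [ exact: is_derive1_cst | exact: is_derive1_id
  | apply: deriv_f => //; lia | apply: deriv_L => //; lia
  | apply: deriv_fV => //; lia
  | eapply is_derive1D | eapply is_derive1N | eapply is_derive1M | eapply is_derive1X ].

(** The derivative is built from the shape of the expression with its value left open; the remaining
    goal compares that value with the tabulated entry. *)
Ltac derive_components :=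
  try exact: is_derive1_cst; eapply is_derive_eq; [repeat derive_step|].

Lemma met_dtE i j t z : I t ->
  is_derive t (1 : R) (fun t => met f t z i j) (met_d f L t z time i j).
Proof.
move=> It; case: i j => [||p b] [||q c]; try exact: is_derive1_cst;
  try have pm := ltn_ord p; try (case: b; case: c);
  rewrite /=; derive_components; rewrite /=; ring.
Qed.

Lemma met_dzE i j t z :
  is_derive z (1 : R) (fun z => met f t z i j) (met_d f L t z base i j).
Proof.
case: i j => [||p b] [||q c]; try exact: is_derive1_cst;
  try have pm := ltn_ord p; try (case: b; case: c);
  rewrite /=; derive_components; rewrite /=; component_field.
Qed.

Lemma chr_dtE k i j t z : I t ->
  is_derive t (1 : R) (fun t => chr f L t z k i j) (chr_dt f L D t z k i j).
Proof.
move=> It; case: k i j => [||p b] [||q c] [||r d]; try exact: is_derive1_cst;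
  try have qm := ltn_ord q; try have pm := ltn_ord p;
  try (case: b); try (case: c); try (case: d);
  rewrite /=; derive_components; rewrite /=; component_field.
Qed.

Lemma chr_dzE k i j t z : I t ->
  is_derive z (1 : R) (fun z => chr f L t z k i j) (chr_dz f L t z k i j).
Proof.
move=> It; case: k i j => [||p b] [||q c] [||r d]; try exact: is_derive1_cst;
  try have qm := ltn_ord q; try have pm := ltn_ord p;
  try (case: b); try (case: c); try (case: d);
  rewrite /=; derive_components; rewrite /=; component_field.
Qed.

End Derivatives.
End Ricci.

Section RicciTensor.
Context {R : realType}.
Variables (m : nat) (I : set R) (f L D : nat -> R -> R).
Notation n := m.*2.+1.
Hypotheses (I_open : open I) (fLD : log_derivatives n I f L D).
Implicit Types (x : slot m) (p q : 'I_m) (y : 'rV[R]_n.+1).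

Let f_neq0 i t : (i <= n)%N -> I t -> f i t != 0.
Proof. by move=> ilen It; case: (fLD ilen It). Qed.

Ltac component_field := field; repeat (apply/andP; split);
  first [by [] | apply: f_neq0 => //; lia].

Lemma partial_met x i j y : I (y ord0 ord0) ->
  partial (slot_ord x)
    (fun y => squares_metric f y (slot_ord i) (slot_ord j)) y
  = met_d f L (y ord0 ord0) (y ord0 ord_max) x i j.
Proof.
move=> Iy; set t := y ord0 ord0; set z := y ord0 ord_max.
transitivity (match x with time => met_d f L t z time i j
    | base => met_d f L t z base i j | fib _ _ => 0 end); last by case: x.
apply: (@partial_slot R m I _ (fun t z => met f t z i j) x y _ _ I_open Iy).
- by move=> y' _; exact: squares_metricE.
- exact: (@met_dtE _ _ I _ _ D).
- exact: met_dzE.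
Qed.

Lemma christoffelE k i j y : I (y ord0 ord0) ->
  christoffel (squares_metric f) (slot_ord k) (slot_ord i) (slot_ord j) y
  = chr f L (y ord0 ord0) (y ord0 ord_max) k i j.
Proof.
move=> Iy; set t := y ord0 ord0; set z := y ord0 ord_max.
have invE l : invmx (squares_metric f y) (slot_ord k) (slot_ord l)
    = inv_met f t z k l.
  by apply: invmx_squares_metric => a alen; exact: f_neq0.
rewrite /christoffel sum_slots !invE.
under eq_bigr do rewrite !invE !partial_met//.
rewrite !partial_met// -/t -/z.
rewrite (sum_inv_met f t z k (fun l => met_d f L t z i j l
  + met_d f L t z j i l - met_d f L t z l i j)).
(* Coincidences of block numbers are separated first: entries mixing distinct blocks vanish, and
   what is left is an identity within one block. *)
case: k i j {invE} => [||p b] [||q c] [||r d];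
  try have rm := ltn_ord r; try have qm := ltn_ord q; try have pm := ltn_ord p;
  rewrite /=; try (by component_field);
  try (case: (eqVneq p q) => [<-|pq]; [rewrite ?eqxx|
    rewrite /= ?[q == p]eq_sym ?(negbTE pq) /=; by component_field]);
  try (case: (eqVneq p r) => [<-|pr]; [rewrite ?eqxx|
    rewrite /= ?[r == p]eq_sym ?(negbTE pr) /=; by component_field]);
  try (case: b); try (case: c); try (case: d); rewrite /=; component_field.
Qed.

Lemma partial_christoffel x k i j y : I (y ord0 ord0) ->
  partial (slot_ord x)
    (christoffel (squares_metric f) (slot_ord k) (slot_ord i) (slot_ord j)) y
  = match x with
    | time => chr_dt f L D (y ord0 ord0) (y ord0 ord_max) k i j
    | base => chr_dz f L (y ord0 ord0) (y ord0 ord_max) k i j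
    | fib _ _ => 0
    end.
Proof.
move=> Iy; apply: (@partial_slot R m I _
  (fun t z => chr f L t z k i j) x y _ _ I_open Iy).
- by move=> y' Iy'; exact: christoffelE.
- exact: (@chr_dtE _ _ I).
- exact: (@chr_dzE _ _ I _ _ D).
Qed.

Let S0 (F : 'I_m -> R) : (forall p, F p = 0) -> \sum_p F p = 0.
Proof. by move=> F0; rewrite big1. Qed.

Let SD p (F G : 'I_m -> R) : (forall q, F q = (p == q)%:R * G q) ->
  \sum_q F q = G p.
Proof. by move=> FG; rewrite -(sum_delta p G); apply: eq_bigr. Qed.

(** The subtracted part is the derivative of a trace that depends on t alone and vanishes unless [i]
    is [time], so it matters only in the time-time component. *)
Lemma ricci_divergence i j y : I (y ord0 ord0) ->
  let t := y ord0 ord0 in let z := y ord0 ord_max in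
  \sum_k (partial k (christoffel (squares_metric f) k (slot_ord i) (slot_ord j)) y
          - partial (slot_ord j)
              (christoffel (squares_metric f) k (slot_ord i) k) y)
  = match i, j with
    | time, time => - expansion_dt m D t
    | base, base => f n t * (D n t + 2 * L n t * (L n t - L 0 t)) * (f 0 t)^-1
    | fib p b, fib q c => (p == q)%:R *
        ((half_dt_dt f L D t z p b c - 2 * L 0 t * half_dt f L t z p b c)
           * (f 0 t)^-1
         - (if b && c then f p.*2.+1 t else 0) * (f n t)^-1)
    | _, _ => 0
    end.
Proof.
move=> Iy t z; rewrite sum_slots.
under eq_bigr do rewrite !partial_christoffel//.
rewrite !partial_christoffel// -/t -/z.
case: i j => [||p b] [||q c] /=; try (rewrite S0; [ring|by move=> r; ring]).
- rewrite /expansion_dt opprD; congr (_ + _); first ring.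
  by rewrite -sumrN; apply: eq_bigr => r _; rewrite eqxx /=; ring.
Qed.

(** The trace is the l-derivative of ln sqrt |det g|. As S is unipotent, det g = - f_0 f_1 ... f_n
    is free of z. *)
Lemma trace_christoffel (l : slot m) y : I (y ord0 ord0) ->
  \sum_k christoffel (squares_metric f) k k (slot_ord l) y
  = match l with
    | time => L 0 (y ord0 ord0) + expansion m L (y ord0 ord0)
    | _ => 0
    end.
Proof.
move=> Iy; rewrite sum_slots.
under eq_bigr do rewrite !christoffelE//.
rewrite !christoffelE//; case: l => [||p b] /=.
- rewrite /expansion addrA; congr (_ + _).
  by apply: eq_bigr => r _; rewrite eqxx !mul1r.
- by rewrite S0; [ring|move=> r; rewrite eqxx /=; ring].
- by rewrite S0; [ring|move=> r; ring].
Qed.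

Lemma ricci_quadratic i j y : I (y ord0 ord0) ->
  let t := y ord0 ord0 in let z := y ord0 ord_max in
  \sum_k \sum_l (christoffel (squares_metric f) k (slot_ord j) l y
                 * christoffel (squares_metric f) l (slot_ord i) k y)
  = match i, j with
    | time, time => L 0 t ^+ 2 + L n t ^+ 2
        + \sum_(p < m) (L p.*2.+1 t ^+ 2 + L p.*2.+2 t ^+ 2)
    | base, base => 2 * f n t * L n t ^+ 2 * (f 0 t)^-1
        + \sum_(p < m) (f p.*2.+1 t * (f p.*2.+2 t)^-1) / 2
    | fib p b, fib q c => (p == q)%:R *
       ((half_dt f L t z p c false * log_dt L t z p false b
         + half_dt f L t z p c true * log_dt L t z p true b
         + log_dt L t z p false c * half_dt f L t z p b false
         + log_dt L t z p true c * half_dt f L t z p b true) * (f 0 t)^-1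
        - (half_dz f t z p c false * log_dz f t z p false b
           + half_dz f t z p c true * log_dz f t z p true b
           + log_dz f t z p false c * half_dz f t z p b false
           + log_dz f t z p true c * half_dz f t z p b true) * (f n t)^-1)
    | _, _ => 0
    end.
Proof.
move=> Iy t z.
(* The inner contraction is done for every [k] first, so the outer sum runs over explicit
   products. *)
have sumE k : \sum_l (christoffel (squares_metric f) (slot_ord k) (slot_ord j) l y
                 * christoffel (squares_metric f) l (slot_ord i) (slot_ord k) y)
  = match k, j with
    | time, time => L 0 t * chr f L t z time i k
    | time, base => f n t * L n t * (f 0 t)^-1 * chr f L t z base i k
    | time, fib p b => half_dt f L t z p b false * (f 0 t)^-1
                         * chr f L t z (fib p false) i k
                       + half_dt f L t z p b true * (f 0 t)^-1
                         * chr f L t z (fib p true) i k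
    | base, time => L n t * chr f L t z base i k
    | base, base => L n t * chr f L t z time i k
    | base, fib p b => - (half_dz f t z p b false * (f n t)^-1
                         * chr f L t z (fib p false) i k
                       + half_dz f t z p b true * (f n t)^-1
                         * chr f L t z (fib p true) i k)
    | fib p b, time => log_dt L t z p b false * chr f L t z (fib p false) i k
                       + log_dt L t z p b true * chr f L t z (fib p true) i k
    | fib p b, base => log_dz f t z p b false * chr f L t z (fib p false) i k
                       + log_dz f t z p b true * chr f L t z (fib p true) i k
    | fib p b, fib q c => (p == q)%:R * (log_dt L t z p b c * chr f L t z time i k
                          + log_dz f t z p b c * chr f L t z base i k)
    end.
  rewrite sum_slots; under eq_bigr do rewrite !christoffelE//.
  by rewrite !christoffelE// (sum_chr f L t z k j (fun l => chr f L t z l i k)).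
rewrite sum_slots (eq_bigr _ (fun p _ => congr2 +%R (sumE _) (sumE _))).
rewrite !sumE {sumE}; case: i j => [||p b] [||q c] /=;
  try (rewrite S0; [ring|by move=> r; ring]).
- congr (_ + _).
  by apply: eq_bigr => r _; rewrite eqxx /=; ring.
- congr (_ + _); first ring.
  by apply: eq_bigr => r _; rewrite eqxx /=; field; apply: f_neq0 => //;
    have := ltn_ord r; lia.
- rewrite [q == p]eq_sym; have [<-|pq] := eqVneq p q; last first.
    rewrite S0 /=; first ring.
    by move=> r; case: eqVneq => [->|_]; rewrite ?(negbTE pq) /=; ring.
  rewrite (@SD p _ (fun r =>
      (log_dt L t z r false c * half_dt f L t z r b false
       + log_dt L t z r true c * half_dt f L t z r b true) * (f 0 t)^-1
    - (log_dz f t z r false c * half_dz f t z r b false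
       + log_dz f t z r true c * half_dz f t z r b true) * (f n t)^-1)).
    by case: b; case: c; rewrite /=; ring.
  move=> r; rewrite [r == p]eq_sym; case: eqVneq => [<-|_].
    by case: b; case: c; rewrite /=; ring.
  by rewrite /=; ring.
Qed.

Lemma ricciE i j y : I (y ord0 ord0) ->
  ricci (squares_metric f) (slot_ord i) (slot_ord j) y
  = ric f L D (y ord0 ord0) (y ord0 ord_max) i j.
Proof.
move=> Iy; set t := y ord0 ord0; set z := y ord0 ord_max.
pose G k i j := christoffel (squares_metric f) k i j y.
have traceE : \sum_k \sum_l G k k l * G l (slot_ord i) (slot_ord j)
    = (L 0 t + expansion m L t) * chr f L t z time i j.
  (* Summing over [k] first exposes the traces, of which only the one at [time] survives. *)
  rewrite exchange_big/=; under eq_bigr do rewrite -mulr_suml.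
  rewrite sum_slots /G !trace_christoffel// !christoffelE//.
  rewrite S0 => [|r]; first by rewrite -/t -/z mul0r !addr0.
  by rewrite !trace_christoffel// !mul0r addr0.
have quadE : \sum_k \sum_l (G k k l * G l (slot_ord i) (slot_ord j)
      - G k (slot_ord j) l * G l (slot_ord i) k)
    = \sum_k \sum_l G k k l * G l (slot_ord i) (slot_ord j)
      - \sum_k \sum_l G k (slot_ord j) l * G l (slot_ord i) k.
  by rewrite -sumrB; apply: eq_bigr => k _; rewrite -sumrB.
rewrite /ricci ricci_divergence// -/t -/z.
rewrite {}/G in traceE quadE; rewrite quadE traceE ricci_quadratic// -/t -/z.
have ft : f 0 t != 0 by exact: f_neq0.
have fb : f n t != 0 by exact: f_neq0.
case: i j {traceE quadE} => [||p b] [||q c] /=; try ring.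
have fo : f p.*2.+1 t != 0 by apply: f_neq0 => //; have := ltn_ord p; lia.
have fe : f p.*2.+2 t != 0 by apply: f_neq0 => //; have := ltn_ord p; lia.
rewrite /ric_odd /ric_even.
by case: b; case: c; rewrite /=; field; rewrite ft fb fe.
Qed.

End RicciTensor.

(** * The field equations *)

Section FieldEquations.
Context {R : realType}.
Variables (m : nat) (I : set R) (f L D : nat -> R -> R).
Notation n := m.*2.+1.

(* The square of the lapse times the square of the structure constant
   a_(2p-1) / (a_(2p) a_n) of the orthonormal frame. *)
Definition twist (p : 'I_m) t : R :=
  f 0 t * f p.*2.+1 t / (f p.*2.+2 t * f n t).

Definition field_equations t : Prop :=
  let th := expansion m L t in
  [/\ expansion_dt m D t
        = th * L 0 t - L n t ^+ 2
          - \sum_(p < m) (L p.*2.+1 t ^+ 2 + L p.*2.+2 t ^+ 2),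
      D n t + L n t * (th - L 0 t) = \sum_p twist p t / 2,
      forall p : 'I_m, D p.*2.+1 t + L p.*2.+1 t * (th - L 0 t) = - (twist p t / 2)
    & forall p : 'I_m, D p.*2.+2 t + L p.*2.+2 t * (th - L 0 t) = twist p t / 2].

(** In the left-invariant frame each spatial diagonal component is the nonzero factor f_i/f_0 times
    the defect of one evolution equation. The time-time component is the defect of the remaining
    equation. *)
Lemma ricci_flat_squares :
  open I -> log_derivatives n I f L D ->
  ricci_flat_on I (squares_metric f : 'rV[R]_n.+1 -> 'M[R]_n.+1)
  <-> forall t, I t -> field_equations t.
Proof.
move=> I_open fLD.
have f_neq0 i t : (i <= n)%N -> I t -> f i t != 0 by move=> il It; case: (fLD i t).
have ric_oddE t (p : 'I_m) : I t -> ric_odd f L D t p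
    = f p.*2.+1 t / f 0 t * (D p.*2.+1 t
        + L p.*2.+1 t * (expansion m L t - L 0 t) + twist p t / 2).
  move=> It; rewrite /ric_odd /twist; field.
  by rewrite !f_neq0//; have := ltn_ord p; lia.
have ric_evenE t (p : 'I_m) : I t -> ric_even f L D t p
    = f p.*2.+2 t / f 0 t * (D p.*2.+2 t
        + L p.*2.+2 t * (expansion m L t - L 0 t) - twist p t / 2).
  move=> It; rewrite /ric_even /twist; field.
  by rewrite !f_neq0//; have := ltn_ord p; lia.
have ric_baseE t : I t -> f n t / f 0 t * (D n t + L n t * (expansion m L t - L 0 t))
                  - \sum_(p < m) (f p.*2.+1 t / f p.*2.+2 t) / 2
    = f n t / f 0 t * (D n t + L n t * (expansion m L t - L 0 t)
                       - \sum_p twist p t / 2).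
  move=> It; rewrite [RHS]mulrBr; congr (_ - _).
  rewrite mulr_sumr; apply: eq_bigr => p _; rewrite /twist; field.
  by rewrite !f_neq0//; have := ltn_ord p; lia.
have quot_neq0 i t : (i <= n)%N -> I t -> f i t / f 0 t != 0.
  by move=> il It; rewrite mulf_neq0 ?invr_neq0 ?f_neq0.
split=> [flat t It|eqs y It i j].
  (* Any point with time coordinate [t] would do; this choice also gives x_n the value [t]. *)
  pose y : 'rV[R]_n.+1 := const_mx t.
  have yt : y ord0 ord0 = t by rewrite mxE.
  have Iy : I (y ord0 ord0) by rewrite yt.
  have ric0 (i j : slot m) : ric f L D t t i j = 0.
    have := flat y Iy (slot_ord i) (slot_ord j).
    by rewrite (@ricciE R m I f L D I_open fLD)// yt mxE.
  have odd0 (p : 'I_m) : ric_odd f L D t p = 0.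
    by have := ric0 (fib p false) (fib p false); rewrite /= eqxx mul1r.
  have even0 (p : 'I_m) : ric_even f L D t p = 0.
    have := ric0 (fib p true) (fib p true).
    by rewrite /= eqxx mul1r odd0 mulr0 addr0.
  split.
  - have := ric0 time time; rewrite /= => /eqP.
    by rewrite -!addrA addrC subr_eq0 => /eqP <-; rewrite !addrA.
  - have := ric0 base base; rewrite /= ric_baseE// => /eqP.
    by rewrite mulf_eq0 (negbTE (quot_neq0 _ _ _ _))//= subr_eq0 => /eqP.
  - move=> p; have := odd0 p; rewrite ric_oddE// => /eqP.
    rewrite mulf_eq0 (negbTE (quot_neq0 _ _ _ _))//=; last first.
      by have := ltn_ord p; lia.
    by rewrite addr_eq0 => /eqP.
  - move=> p; have := even0 p; rewrite ric_evenE// => /eqP.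
    rewrite mulf_eq0 (negbTE (quot_neq0 _ _ _ _))//=; last first.
      by have := ltn_ord p; lia.
    by rewrite subr_eq0 => /eqP.
have [u ->] := slot_ord_surj i; have [v ->] := slot_ord_surj j.
rewrite (@ricciE R m I f L D I_open fLD)//.
have [eqt eqb eqo eqe] := eqs _ It; move: (y ord0 ord0) It eqt eqb eqo eqe.
move=> t It eqt eqb eqo eqe.
case: u v => [||p b] [||q c] //=.
- by rewrite eqt; ring.
- by rewrite ric_baseE// eqb subrr mulr0.
- rewrite ric_oddE// ric_evenE// eqo eqe addNr subrr !mulr0.
  by case: b; case: c; rewrite ?oppr0 ?mulr0 ?addr0 ?mulr0.
Qed.

End FieldEquations.

(** * The explicit solution in exponential form *)

Section Profiles.
Context {R : realType}.
Variable m : nat.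
Notation n := m.*2.+1.

Lemma cosh_gt0 (x : R) : 0 < cosh x.
Proof. by rewrite divr_gt0// addr_gt0// expR_gt0. Qed.

Definition tanh (x : R) : R := (expR x - expR (- x)) / (expR x + expR (- x)).

Lemma tanh_cosh (x : R) : 1 - tanh x ^+ 2 = cosh x ^- 2.
Proof.
have e0 : expR x + expR (- x) != 0 by rewrite gt_eqF// addr_gt0// expR_gt0.
have e1 : expR x * expR (- x) = 1 by rewrite -expRD subrr expR0.
rewrite /tanh /cosh; move: (expR x) (expR (- x)) e0 e1 => a b e0 e1.
transitivity (4 * (a * b) / (a + b) ^+ 2); first by field.
by rewrite e1; field.
Qed.

Lemma is_derive1_ln_cosh (k t : R) :
  is_derive t (1 : R) (fun t => ln (cosh (k * t))) (k * tanh (k * t)).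
Proof.
have kt : is_derive t (1 : R) (fun t => k * t) k.
  apply: (is_derive_eq (is_derive1M (is_derive1_cst k t) (is_derive1_id t))).
  by rewrite mul0r add0r mulr1.
have ct : is_derive t (1 : R) (fun t => cosh (k * t))
    (k * (expR (k * t) - expR (- (k * t))) / 2).
  apply: (is_derive_eq (is_derive1M (is_derive1D (is_derive1_expRf kt)
    (is_derive1_expRf (is_derive1N kt))) (is_derive1_cst 2^-1 t))).
  by rewrite mulr0 addr0 mulNr -mulrBr.
have h := @is_derive1_lnf R (fun t => cosh (k * t)) t _ (cosh_gt0 _) ct.
apply: (is_derive_eq h).
rewrite /tanh /cosh; field.
by rewrite gt_eqF// addr_gt0// expR_gt0.
Qed.

Lemma is_derive1_tanh (k t : R) :
  is_derive t (1 : R) (fun t => tanh (k * t)) (k * cosh (k * t) ^- 2).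
Proof.
have kt : is_derive t (1 : R) (fun t => k * t) k.
  apply: (is_derive_eq (is_derive1M (is_derive1_cst k t) (is_derive1_id t))).
  by rewrite mul0r add0r mulr1.
have e0 : expR (k * t) + expR (- (k * t)) != 0.
  by rewrite gt_eqF// addr_gt0// expR_gt0.
have ep := is_derive1_expRf kt.
have em := is_derive1_expRf (is_derive1N kt).
have q := @is_derive1V R (fun t => expR (k * t) + expR (- (k * t))) t _ e0
  (is_derive1D ep em).
apply: (is_derive_eq (is_derive1M (is_derive1D ep (is_derive1N em)) q)).
by rewrite -tanh_cosh /tanh; field.
Qed.

(* Exponent of cosh (k t) in the square of the i-th scale factor, the lapse
   being numbered 0. *)
Definition weight (i : nat) : R :=
  if (i == 0%N) || (i == n) then m%:R else if odd i then - 1 else 1.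

Lemma weight0 : weight 0 = m%:R. Proof. by []. Qed.

Lemma weight_base : weight n = m%:R.
Proof. by rewrite /weight eqxx orbT. Qed.

Lemma weight_odd (p : 'I_m) : weight p.*2.+1 = - 1.
Proof.
rewrite /weight /= odd_double /= ifF//.
by apply/negbTE; have := ltn_ord p; lia.
Qed.

Lemma weight_even (p : 'I_m) : weight p.*2.+2 = 1.
Proof.
rewrite /weight /= odd_double /= ifF//.
by apply/negbTE; have := ltn_ord p; lia.
Qed.

(** With the constants entered as logarithms [lc], products and quotients of squared factors become
    sums of exponents. *)
Definition profile (lc H : nat -> R) (k : R) (i : nat) (t : R) : R :=
  expR (2 * (lc i + H i * t) + weight i * ln (cosh (k * t))).

Lemma profile_log_derivatives (I : set R) (lc H : nat -> R) (k : R) :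
  log_derivatives n I (profile lc H k)
    (fun i t => H i + weight i / 2 * (k * tanh (k * t)))
    (fun i t => weight i / 2 * (k ^+ 2 * cosh (k * t) ^- 2)).
Proof.
move=> i t _ _; split; first by rewrite gt_eqF// expR_gt0.
  have h1 := is_derive1D (is_derive1_cst (lc i) t)
    (is_derive1M (is_derive1_cst (H i) t) (is_derive1_id t)).
  have h2 := is_derive1D (is_derive1M (is_derive1_cst 2 t) h1)
    (is_derive1M (is_derive1_cst (weight i) t) (is_derive1_ln_cosh k t)).
  apply: (is_derive_eq (is_derive1_expRf h2)).
  by rewrite /profile; congr (_ * _); field.
have h := is_derive1D (is_derive1_cst (H i) t)
  (is_derive1M (is_derive1_cst (weight i / 2) t)
    (is_derive1M (is_derive1_cst k t) (is_derive1_tanh k t))).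
by apply: (is_derive_eq h); ring.
Qed.

Definition exponents (h : nat -> R) (i : nat) : R :=
  if i is 0%N then \tr (hmx n h) else h i.

Lemma trace_hmx (h : nat -> R) :
  \tr (hmx n h) = \sum_(p < m) (h p.*2.+1 + h p.*2.+2) + h n.
Proof.
rewrite mxtrace_diag -sum_odd_even big_add1/= big_mkord.
by apply: eq_bigr => i _; rewrite mxE.
Qed.

Lemma trace_hmx_sqr (h : nat -> R) :
  \tr (hmx n h *m hmx n h)
  = \sum_(p < m) (h p.*2.+1 ^+ 2 + h p.*2.+2 ^+ 2) + h n ^+ 2.
Proof.
rewrite -(trace_hmx (fun i => h i ^+ 2)) /hmx mulmx_diag; congr (\tr (diag_mx _)).
by apply/rowP => i; rewrite !mxE expr2.
Qed.

Lemma vacuum_metricE (c h : nat -> R) y :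
  (forall i, (i <= n)%N -> 0 < c i) ->
  vacuum_metric n c h y
  = squares_metric (profile (fun i => ln (c i)) (exponents h) (kconst n c)) y.
Proof.
move=> c0; rewrite /vacuum_metric /squares_metric.
set t := y ord0 ord0; set k := kconst n c.
have lncK : cosh (k * t) = expR (ln (cosh (k * t))).
  by rewrite lnK// posrE cosh_gt0.
have profE i : (i <= n)%N -> profile (fun i => ln (c i)) (exponents h) k i t
    = c i ^+ 2 * expR (2 * exponents h i * t)
      * expR (weight i * ln (cosh (k * t))).
  move=> il; rewrite /profile mulrDr !expRD mulrA -[in RHS](lnK (c0 i il)).
  by rewrite -expRM_natl.
have powE : expR (m%:R * ln (cosh (k * t))) = cosh (k * t) ^+ m.
  by rewrite expRM_natl -lncK.
rewrite (sum_odd_even m (fun i =>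
  profile (fun i => ln (c i)) (exponents h) k i t *: sq (omega i y))).
rewrite /= doubleK big_add1/= big_mkord.
rewrite scalerDr -addrA; congr (_ + _).
  rewrite scalerA profE// weight0 powE; congr (_ *: _); rewrite /=; ring.
rewrite addrC; congr (_ + _).
  apply: eq_bigr => p _; have pm := ltn_ord p.
  congr (_ *: _ + _ *: _).
    rewrite profE; last by lia.
    rewrite weight_odd mulN1r expRN -lncK /=; ring.
  rewrite profE; last by lia.
  rewrite weight_even mul1r -lncK /=; ring.
rewrite scalerA profE// weight_base powE; congr (_ *: _); rewrite /=; ring.
Qed.

End Profiles.

(** * Ricci-flatness of the explicit metric *)

Section VacuumMetric.
Context {R : realType}.
Variable m : nat.
Notation n := m.*2.+1.

(** The equation exp (2 b t) = 1 forces b = 0 only at a nonzero time. *)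
Lemma open_neq0 (I : set R) : open I -> I !=set0 -> exists2 t, I t & t != 0.
Proof.
move=> I_open [t It]; have [t0|t0] := eqVneq t 0; last by exists t.
have In : \forall s \near 0^', I s.
  by apply: nbhs_dnbhs; rewrite -t0; exact: open_near.
have n0 : \forall s \near (0 : R)^', s != 0 by exact: nbhs_dnbhs_neq.
have In0 : \forall s \near 0^', I s /\ s != 0 by exact: filterI.
by have [s [Is s0]] := @filter_ex _ _ (Proper_dnbhs_numFieldType (0 : R)) _ In0; exists s.
Qed.

Lemma balanceP (h : nat -> R) : exponent_balance n h <->
  forall p : 'I_m, h p.*2.+1 + \tr (hmx n h) = h p.*2.+2 + h n.
Proof.
rewrite /exponent_balance /= doubleK; split=> [bal p|bal p].
  by apply: (bal p.+1); rewrite ltn_ord.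
case: p => // p /andP[_ pm]; exact: (bal (Ordinal pm)).
Qed.

(** The weights combine to m - 1 - 1 - m = -2, whence cosh^-2, and the equal ratios of constants
    give the same factor k^2 for every block. *)
Lemma vacuum_twist (c h : nat -> R) (p : 'I_m) t :
  vacuum_constants n c h ->
  twist (profile m (fun i => ln (c i)) (exponents m h) (kconst n c)) p t
  = kconst n c ^+ 2 * cosh (kconst n c * t) ^- 2
    * expR (2 * (h p.*2.+1 + \tr (hmx n h) - h p.*2.+2 - h n) * t).
Proof.
move=> [c0 ratio _]; have pm := ltn_ord p.
have co : 0 < c p.*2.+1 by apply: c0; lia.
have ce : 0 < c p.*2.+2 by apply: c0; lia.
have cb : 0 < c n by apply: c0.
have ct : 0 < c 0 by apply: c0.
have kE : kconst n c = c 0 * c p.*2.+1 / (c p.*2.+2 * c n).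
  have := ratio p.+1; rewrite /= doubleK ltn_ord => /(_ isT) e.
  rewrite /kconst !invfM !mulrA -[c 0 * c 1 / c 2]mulrA -e.
  by rewrite [c 0 * (_ / _)]mulrA.
set k := kconst n c in kE *; rewrite /twist /profile.
have kE2 : k ^+ 2
    = expR (2 * (ln (c 0) + ln (c p.*2.+1) - ln (c p.*2.+2) - ln (c n))).
  rewrite expRM_natl !expRD !expRN !lnK// kE; congr (_ ^+ _).
  by field; rewrite !gt_eqF.
have cE : cosh (k * t) ^- 2 = expR (- (2 * ln (cosh (k * t)))).
  by rewrite expRN expRM_natl lnK// posrE cosh_gt0.
rewrite kE2 cE -!expRD -expRN -expRD; congr expR.
rewrite weight0 weight_base weight_odd weight_even /=; ring.
Qed.

Lemma vacuum_metric_flat (I : set R) (c h : nat -> R) :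
  (0 < m)%N -> open I -> I !=set0 -> vacuum_constants n c h ->
  ricci_flat_on I (vacuum_metric n c h) <-> exponent_balance n h.
Proof.
move=> m0 I_open I_neq0 vc; have [c0 _ constr] := vc.
have k0 : kconst n c != 0.
  by rewrite /kconst mulf_neq0 ?invr_neq0 ?mulf_neq0// gt_eqF ?c0//; lia.
have -> : vacuum_metric n c h
    = squares_metric (profile m (fun i => ln (c i)) (exponents m h) (kconst n c)).
  by apply/funext => y; exact: vacuum_metricE.
set k := kconst n c in k0 constr *.
set f := profile _ _ _ _; set H := exponents m h.
pose L i t : R := H i + weight m i / 2 * (k * tanh (k * t)).
pose D i t : R := weight m i / 2 * (k ^+ 2 * cosh (k * t) ^- 2).
have fLD : log_derivatives n I f L D by exact: profile_log_derivatives.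
rewrite (ricci_flat_squares I_open fLD) balanceP.
(* The weights cancel within each block and the base has the weight of the lapse. Hence the time
   coordinate is already harmonic, and the terms L_i (theta - L_0) drop out. *)
have thE t : expansion m L t = L 0 t.
  rewrite /expansion (eq_bigr (fun p : 'I_m => h p.*2.+1 + h p.*2.+2)).
    by rewrite /L /H /= trace_hmx weight_base weight0; ring.
  by move=> p _; rewrite /L weight_odd weight_even /=; field.
have twE t (p : 'I_m) : twist f p t = k ^+ 2 * cosh (k * t) ^- 2
    * expR (2 * (h p.*2.+1 + \tr (hmx n h) - h p.*2.+2 - h n) * t).
  exact: (vacuum_twist p t vc).
have cosh0 t : cosh (k * t) ^- 2 != 0.
  by rewrite invr_neq0// expf_neq0// gt_eqF// cosh_gt0.
split=> [eqs p|bal t It].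
  have [t It t0] := open_neq0 I_open I_neq0.
  have [_ _ /(_ p) eqo _] := eqs t It.
  (* Both sides contain k^2 cosh^-2 (k t); cancelling it leaves exp (2 b t) = 1. *)
  move: eqo; rewrite thE subrr mulr0 addr0 /D weight_odd twE !mulNr => /oppr_inj.
  rewrite mul1r mulrC => /(mulIf (_ : 2^-1 != 0)); rewrite invr_eq0 pnatr_eq0.
  move=> /(_ isT); rewrite -[LHS]mulr1 => /(mulfI (mulf_neq0 _ (cosh0 t))).
  rewrite expf_eq0/= k0 => /(_ isT) /esym/eqP.
  rewrite -[X in _ == X]expR0 => /eqP/expR_inj/eqP.
  rewrite !mulf_eq0 (negbTE t0) orbF pnatr_eq0/= subr_eq0 subr_eq addrC => /eqP ->.
  by rewrite addrC.
have tw0 (p : 'I_m) : twist f p t = k ^+ 2 * cosh (k * t) ^- 2.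
  rewrite twE (_ : h p.*2.+1 + \tr (hmx n h) - h p.*2.+2 - h n = 0).
    by rewrite mulr0 mul0r expR0 mulr1.
  by rewrite bal; ring.
rewrite /field_equations /= thE; split.
- have sumC (x : R) : \sum_(p < m) x = m%:R * x.
    by rewrite sumr_const card_ord mulr_natl.
  have expE : expansion_dt m D t = m%:R / 2 * (k ^+ 2 * cosh (k * t) ^- 2).
    rewrite /expansion_dt big1 => [|p _]; first by rewrite addr0 /D weight_base.
    by rewrite /D weight_odd weight_even; ring.
  have sqE : \sum_(p < m) (L p.*2.+1 t ^+ 2 + L p.*2.+2 t ^+ 2)
      = \sum_(p < m) (h p.*2.+1 ^+ 2 + h p.*2.+2 ^+ 2)
        + m%:R * (k * tanh (k * t) * (\tr (hmx n h) - h n)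
                  + (k * tanh (k * t)) ^+ 2 / 2).
    rewrite -sumC -big_split; apply: eq_bigr => p _ /=.
    (* By balance, the coefficient of the cross term k tanh (k t) is the same in all blocks. *)
    have -> : \tr (hmx n h) - h n = h p.*2.+2 - h p.*2.+1.
      by rewrite (canRL (addKr _) (bal p)); ring.
    by rewrite /L weight_odd weight_even /=; field.
  have {}constr : \sum_(p < m) (h p.*2.+1 ^+ 2 + h p.*2.+2 ^+ 2)
      = \tr (hmx n h) ^+ 2 - h n ^+ 2 - m%:R / 2 * k ^+ 2.
    have dm : (n.-1)%:R = m%:R * 2 :> R by rewrite /= -muln2 natrM.
    move: constr; rewrite dm trace_hmx_sqr; set S := \sum_(p < m) _ => constr.
    rewrite [LHS](_ : S = \tr (hmx n h) ^+ 2 - h n ^+ 2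
      - (\tr (hmx n h) ^+ 2 - (S + h n ^+ 2))); last by ring.
    by rewrite constr; field.
  by rewrite expE sqE constr -tanh_cosh /L weight0 weight_base /=; field.
- rewrite subrr mulr0 addr0 (eq_bigr (fun=> k ^+ 2 * cosh (k * t) ^- 2 / 2)).
    by rewrite sumr_const card_ord -[RHS]mulr_natl /D weight_base; ring.
  by move=> p _; rewrite tw0.
- by move=> p; rewrite tw0 /D weight_odd; ring.
- by move=> p; rewrite tw0 /D weight_even; ring.
Qed.

End VacuumMetric.

(** * Integration of the field equations *)

Section Integration.
Context {R : realType}.
Variables (m : nat) (I : set R) (f phi L D : nat -> R -> R) (s0 : R).
Notation n := m.*2.+1.
Hypotheses (m_gt0 : (0 < m)%N) (I_open : open I) (I_itv : is_interval I).
Hypotheses (Is0 : I s0).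
Hypothesis fE : forall i t, (i <= n)%N -> I t -> f i t = expR (2 * phi i t).
Hypothesis phiD : forall i t, (i <= n)%N -> I t ->
  is_derive t (1 : R) (phi i) (L i t).
Hypothesis LD : forall i t, (i <= n)%N -> I t ->
  is_derive t (1 : R) (L i) (D i t).
(** Here [phi i] is the logarithm of a_i, or of N for i = 0. Equal differences make all twists
    equal, as [twistE] shows. *)
Hypothesis ratio : forall (p : 'I_m) t, I t ->
  phi p.*2.+1 t - phi p.*2.+2 t = phi 1 t - phi 2 t.
Hypothesis eqs : forall t, I t -> field_equations m f L D t.

Implicit Types (p : 'I_m) (t : R).
Notation wt := (weight m : nat -> R).
Notation th := (expansion m L).

Let odd_le p : (p.*2.+1 <= n)%N. Proof. by have := ltn_ord p; lia. Qed.
Let even_le p : (p.*2.+2 <= n)%N. Proof. by have := ltn_ord p; lia. Qed.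
Let two_le : (2 <= n)%N. Proof. by have := m_gt0; lia. Qed.
Let p0 : 'I_m := Ordinal m_gt0.

Let w1 : wt 1 = - 1. Proof. exact: (weight_odd p0). Qed.
Let w2 : wt 2 = 1. Proof. exact: (weight_even p0). Qed.

Lemma ratio_derivative p t : I t ->
  L p.*2.+1 t - L p.*2.+2 t = L 1 t - L 2 t.
Proof.
move=> It.
have d1 := is_derive1D (phiD (odd_le p) It) (is_derive1N (phiD (even_le p) It)).
have d2 := is_derive1D (phiD (ltn0Sn _ : (1 <= n)%N) It)
  (is_derive1N (phiD two_le It)).
have d3 : is_derive t (1 : R) (fun t => phi 1 t - phi 2 t)
    (L p.*2.+1 t - L p.*2.+2 t).
  apply: near_eq_is_derive d1; have := open_near I_open It.
  by apply: filterS => s Is; rewrite ratio.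
by have <- := @derive_val _ _ _ _ _ _ _ d3; exact: (@derive_val _ _ _ _ _ _ _ d2).
Qed.

(* The harmonic time tau has dtau/dt = N / volume = 1 / inv_sigma. *)
Definition log_volume t : R :=
  phi n t + \sum_(p < m) (phi p.*2.+1 t + phi p.*2.+2 t).
Definition inv_sigma t : R := expR (log_volume t - phi 0 t).
Definition common_twist t : R :=
  expR (2 * (phi 0 t + phi 1 t - phi 2 t - phi n t)).

Lemma log_volume_derivative t : I t -> is_derive t (1 : R) log_volume (th t).
Proof.
move=> It; apply: is_derive1D; first exact: phiD.
apply: is_derive1_sum => p _; apply: is_derive1D; apply: phiD => //.
Qed.

Lemma inv_sigma_gt0 t : 0 < inv_sigma t. Proof. exact: expR_gt0. Qed.

Lemma inv_sigma_derivative t : I t ->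
  is_derive t (1 : R) inv_sigma ((th t - L 0 t) * inv_sigma t).
Proof.
move=> It; apply: is_derive1_expRf; apply: is_derive1D.
  exact: log_volume_derivative.
by apply: is_derive1N; exact: phiD.
Qed.

Lemma twistE p t : I t -> twist f p t = common_twist t.
Proof.
move=> It; rewrite /twist !fE// -expRD -expRD -expRN -expRD.
congr expR; rewrite -[phi 0 t + _ - _]addrA -(ratio p It); ring.
Qed.

(** The weights unify the three kinds of evolution equations: in the one along [base], m equal
    twists add up. *)
Lemma field_equationE i t : (0 < i <= n)%N -> I t ->
  D i t + L i t * (th t - L 0 t) = wt i / 2 * common_twist t.
Proof.
move=> /andP[i0 il] It; have [_ eqb eqo eqe] := eqs It.
have [x /(congr1 val)] := @slot_ord_surj m (inord i).
rewrite /= inordK// val_slot_ord; case: x => [||p []] e; first by rewrite e in i0.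
- rewrite e eqb weight_base (eq_bigr (fun=> common_twist t / 2)) => [|p _].
    by rewrite sumr_const card_ord -[LHS]mulr_natl; ring.
  by rewrite twistE.
- by rewrite e eqe weight_even twistE//; ring.
- by rewrite e eqo weight_odd twistE//; ring.
Qed.

(** The derivative of ln a_i with respect to harmonic time. *)
Definition slope i t : R := L i t * inv_sigma t.

(** [inv_sigma] is an integrating factor: its logarithmic derivative theta - L_0 absorbs the
    first-order term of the evolution equation. *)
Lemma slope_derivative i t : (0 < i <= n)%N -> I t ->
  is_derive t (1 : R) (slope i) (wt i / 2 * common_twist t * inv_sigma t).
Proof.
move=> il It; have /andP[_ il'] := il.
apply: (is_derive_eq (is_derive1M (LD il' It) (inv_sigma_derivative It))).
by rewrite -field_equationE//; ring.
Qed.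

(** The function w = ln (twist / (dtau/dt)^2), in which the lapse cancels; [density_slope] is
    dw/dtau. *)
Definition log_density t : R :=
  2 * (log_volume t + phi 1 t - phi 2 t - phi n t).
Definition density_slope t : R :=
  2 * (th t * inv_sigma t + slope 1 t - slope 2 t - slope n t).

Lemma common_twistE t : common_twist t * inv_sigma t ^+ 2 = expR (log_density t).
Proof.
rewrite /common_twist /inv_sigma -expRM_natl -expRD; congr expR.
rewrite /log_density; ring.
Qed.

Lemma log_density_derivative t : I t ->
  is_derive t (1 : R) log_density (density_slope t / inv_sigma t).
Proof.
move=> It; have h := is_derive1M (is_derive1_cst 2 t)
  (is_derive1D (is_derive1D (is_derive1D (log_volume_derivative It)
    (phiD (ltn0Sn _ : (1 <= n)%N) It)) (is_derive1N (phiD two_le It)))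
    (is_derive1N (phiD (leqnn n) It))).
apply: (is_derive_eq h); rewrite /density_slope /slope; field.
by rewrite gt_eqF// inv_sigma_gt0.
Qed.

Lemma sum_weights : \sum_(p < m) (wt p.*2.+1 + wt p.*2.+2) + wt n = m%:R.
Proof.
rewrite big1 ?add0r ?weight_base// => p _.
by rewrite weight_odd weight_even addNr.
Qed.

Lemma total_slope t : th t * inv_sigma t
  = \sum_(p < m) (slope p.*2.+1 t + slope p.*2.+2 t) + slope n t.
Proof.
rewrite /expansion mulrDl mulr_suml addrC; congr (_ + _).
by apply: eq_bigr => p _; rewrite mulrDl.
Qed.

(** This is d^2 w / dtau^2 = - 2 exp w. The weights cancel within blocks and for the base, leaving
    -1 - 1 from the separate slopes 1 and 2. *)
Lemma density_slope_derivative t : I t ->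
  is_derive t (1 : R) density_slope (- (2 * common_twist t * inv_sigma t)).
Proof.
move=> It.
have K i : (0 < i <= n)%N -> _ := fun il => slope_derivative il It.
have h := is_derive1M (is_derive1_cst 2 t)
  (is_derive1D (is_derive1D (is_derive1D (is_derive1D
    (@is_derive1_sum R _ (index_enum 'I_m) predT
      (fun p t => slope p.*2.+1 t + slope p.*2.+2 t) _ t
      (fun p _ => is_derive1D (K p.*2.+1 (odd_le p)) (K p.*2.+2 (even_le p))))
    (K n (leqnn n)))
  (K 1%N isT)) (is_derive1N (K 2%N two_le))) (is_derive1N (K n (leqnn n)))).
(* The term in theta is expanded into slopes, whose derivatives are known. *)
rewrite (_ : density_slope = (fun t => 2 * (\sum_(p < m)
    (slope p.*2.+1 t + slope p.*2.+2 t) + slope n t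
    + slope 1 t - slope 2 t - slope n t))).
  apply: (is_derive_eq h).
  rewrite mul0r add0r big1 => [|p _]; last by rewrite weight_odd weight_even; ring.
  by rewrite w1 w2; field.
by apply/funext => s; rewrite /density_slope total_slope.
Qed.

Lemma energy_conserved s t : I s -> I t ->
  density_slope s ^+ 2 + 4 * expR (log_density s)
  = density_slope t ^+ 2 + 4 * expR (log_density t).
Proof.
apply: (@is_derive1_0_cst R I
  (fun t => density_slope t ^+ 2 + 4 * expR (log_density t)) I_itv) => {}t It.
have h := is_derive1D (is_derive1X 2 (density_slope_derivative It))
  (is_derive1M (is_derive1_cst 4 t)
    (is_derive1_expRf (log_density_derivative It))).
apply: (is_derive_eq h); rewrite -common_twistE /=; field.
by rewrite gt_eqF// inv_sigma_gt0.
Qed.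

Definition frequency : R :=
  Num.sqrt (density_slope s0 ^+ 2 + 4 * expR (log_density s0)) / 2.

Notation k := frequency.

Lemma frequency_gt0 : 0 < k.
Proof.
by rewrite divr_gt0// sqrtr_gt0 ltr_wpDl ?sqr_ge0// mulr_gt0// expR_gt0.
Qed.

Lemma energyE t : I t ->
  (2 * k - density_slope t) * (2 * k + density_slope t)
  = 4 * expR (log_density t).
Proof.
move=> It; rewrite -[RHS](addKr (density_slope t ^+ 2)) (energy_conserved It Is0).
have -> : 2 * k = Num.sqrt (density_slope s0 ^+ 2 + 4 * expR (log_density s0)).
  by rewrite /frequency mulrC divfK.
have E0 : 0 <= density_slope s0 ^+ 2 + 4 * expR (log_density s0).
  by rewrite addr_ge0 ?sqr_ge0// mulr_ge0// expR_ge0.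
by rewrite -subr_sqr sqr_sqrtr// addrC.
Qed.

(** The product is positive by [energyE], and one factor is positive whatever the sign of the
    density slope. The logarithms in [harmonic_time] need both. *)
Lemma density_slope_bounds t : I t ->
  0 < 2 * k - density_slope t /\ 0 < 2 * k + density_slope t.
Proof.
move=> It; have k0 := frequency_gt0.
have : 0 < (2 * k - density_slope t) * (2 * k + density_slope t).
  by rewrite energyE// mulr_gt0// expR_gt0.
have [d0|d0] := leP 0 (density_slope t).
  have b0 : 0 < 2 * k + density_slope t by rewrite ltr_wpDr// mulr_gt0.
  by rewrite pmulr_lgt0.
have a0 : 0 < 2 * k - density_slope t by rewrite subr_gt0 (lt_trans d0)// mulr_gt0.
by rewrite pmulr_rgt0.
Qed.

(* Harmonic time, normalised by tanh (k tau) = - density_slope / (2 k). *)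
Definition harmonic_time t : R :=
  (ln (2 * k - density_slope t) - ln (2 * k + density_slope t)) / (2 * k).

Lemma harmonic_time_derivative t : I t ->
  is_derive t (1 : R) harmonic_time (inv_sigma t)^-1.
Proof.
move=> It; have [a0 b0] := density_slope_bounds It.
have k0 := frequency_gt0.
have yd := density_slope_derivative It.
have ad := is_derive1D (is_derive1_cst (2 * k) t) (is_derive1N yd).
have bd := is_derive1D (is_derive1_cst (2 * k) t) yd.
have la := @is_derive1_lnf R (fun t => 2 * k - density_slope t) t _ a0 ad.
have lb := @is_derive1_lnf R (fun t => 2 * k + density_slope t) t _ b0 bd.
have h := is_derive1M (is_derive1D la (is_derive1N lb))
  (is_derive1_cst (2 * k)^-1 t).
apply: (is_derive_eq h).
have r0 := inv_sigma_gt0 t; have e := energyE It.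
rewrite -common_twistE in e.
(* Sum and product of the two factors A and B determine k and the twist, which reduces the claim to
   a rational identity in A, B and [inv_sigma]. *)
have AB : (2 * k - density_slope t) + (2 * k + density_slope t) = 4 * k by ring.
move: (2 * k - density_slope t) (2 * k + density_slope t) a0 b0 e AB {ad bd la lb h}.
move=> A B A0 B0 e AB.
have -> : common_twist t = A * B / (4 * inv_sigma t ^+ 2).
  by rewrite e; field; rewrite gt_eqF.
have -> : k = (A + B) / 4 by rewrite AB; field.
by field; rewrite !gt_eqF// addr_gt0.
Qed.

(** With A, B = 2 k -+ dw/dtau one has exp (2 k tau) = A/B, so cosh^2 (k tau) = (A + B)^2 / (4 A B)
    = k^2 exp (- w). *)
Lemma ln_cosh_harmonic_time t : I t ->
  ln (cosh (k * harmonic_time t)) = ln k - log_density t / 2.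
Proof.
move=> It; have [a0 b0] := density_slope_bounds It.
have k0 := frequency_gt0; have e := energyE It.
set x := k * harmonic_time t.
have x2 : expR x ^+ 2 = (2 * k - density_slope t) / (2 * k + density_slope t).
  rewrite -expRM_natl (_ : 2 * x = ln (2 * k - density_slope t)
    - ln (2 * k + density_slope t)); last first.
    by rewrite /x /harmonic_time; field; rewrite gt_eqF.
  by rewrite expRD expRN !lnK.
have xn2 : expR (- x) ^+ 2 = (2 * k + density_slope t) / (2 * k - density_slope t).
  by rewrite expRN exprVn x2 invf_div.
have xx : expR x * expR (- x) = 1 by rewrite -expRD subrr expR0.
have w0 : 0 < expR (log_density t / 2) by exact: expR_gt0.
have wE : expR (log_density t / 2) ^+ 2 = expR (log_density t).
  by rewrite -expRM_natl; congr expR; field.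
suff -> : cosh x = k / expR (log_density t / 2).
  by rewrite ln_div ?posrE// expRK.
apply/eqP; rewrite -(@eqrXn2 _ 2)//; last 2 first.
- exact/ltW/cosh_gt0.
- by rewrite divr_ge0// ltW.
apply/eqP; rewrite [RHS]expr_div_n wE.
have -> : cosh x ^+ 2
    = (expR x ^+ 2 + expR (- x) ^+ 2 + 2 * (expR x * expR (- x))) / 4.
  by rewrite /cosh; field.
rewrite x2 xn2 xx.
have -> : expR (log_density t)
    = (2 * k - density_slope t) * (2 * k + density_slope t) / 4.
  by rewrite e; field.
by field; rewrite !gt_eqF.
Qed.

(* Every logarithm of a scale factor is affine in the harmonic time up to a
   multiple of ln cosh, since its slope is conserved after correction by the
   density slope. *)
Definition exponent i : R := slope i s0 + wt i / 4 * density_slope s0.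

Lemma slope_affine i t : (0 < i <= n)%N -> I t ->
  slope i t = exponent i - wt i / 4 * density_slope t.
Proof.
move=> il It; apply/(canRL (addrK _)).
apply: (@is_derive1_0_cst R I
  (fun t => slope i t + wt i / 4 * density_slope t) I_itv) => // {}t {}It.
have h := is_derive1D (slope_derivative il It)
  (is_derive1M (is_derive1_cst (wt i / 4) t) (density_slope_derivative It)).
by apply: (is_derive_eq h); field.
Qed.

(** The integration constant of [phi_affine], read off at [s0], where ln k - w/2 stands for ln cosh
    (k tau). *)
Definition log_coefficient i : R :=
  phi i s0 - exponent i * harmonic_time s0
  - wt i / 2 * (ln k - log_density s0 / 2).

Lemma phi_affine i t : (0 < i <= n)%N -> I t ->
  phi i t = log_coefficient i + exponent i * harmonic_time t
            + wt i / 2 * ln (cosh (k * harmonic_time t)).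
Proof.
move=> il It; rewrite ln_cosh_harmonic_time//.
pose q t := phi i t - exponent i * harmonic_time t
  - wt i / 2 * (ln k - log_density t / 2).
suff -> : log_coefficient i = q t by rewrite /q; ring.
apply: (@is_derive1_0_cst R I q I_itv) => // {}t {}It.
have /andP[_ il'] := il.
have h := is_derive1D (is_derive1D (phiD il' It)
  (is_derive1N (is_derive1M (is_derive1_cst (exponent i) t)
    (harmonic_time_derivative It))))
  (is_derive1N (is_derive1M (is_derive1_cst (wt i / 2) t)
    (is_derive1D (is_derive1_cst (ln k) t) (is_derive1N
      (is_derive1M (log_density_derivative It) (is_derive1_cst 2^-1 t)))))).
apply: (is_derive_eq h).
have -> : exponent i = slope i t + wt i / 4 * density_slope t.
  by rewrite slope_affine// subrK.
rewrite /slope.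
by field; rewrite gt_eqF// inv_sigma_gt0.
Qed.

(** Applied to [exponent] it yields tr h, and applied to [log_coefficient] it yields ln c_0. *)
Definition total (F : nat -> R) : R :=
  \sum_(p < m) (F p.*2.+1 + F p.*2.+2) + F n.

Lemma total_exponent :
  total exponent = th s0 * inv_sigma s0 + m%:R / 4 * density_slope s0.
Proof.
rewrite total_slope -sum_weights /total /exponent !mulrDl !mulr_suml.
rewrite addrACA -big_split; congr (_ + _).
by apply: eq_bigr => p _ /=; ring.
Qed.

Lemma log_volume_affine t : I t ->
  log_volume t = total log_coefficient + total exponent * harmonic_time t
                 + m%:R / 2 * ln (cosh (k * harmonic_time t)).
Proof.
move=> It; set C := ln (cosh _); set T := harmonic_time t.
rewrite -sum_weights /total /log_volume.
rewrite (phi_affine (leqnn n : (0 < n <= n)%N) It) -/C -/T.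
rewrite (_ : \sum_(p < m) (phi p.*2.+1 t + phi p.*2.+2 t)
  = \sum_(p < m) (log_coefficient p.*2.+1 + log_coefficient p.*2.+2)
    + (\sum_(p < m) (exponent p.*2.+1 + exponent p.*2.+2)) * T
    + (\sum_(p < m) (wt p.*2.+1 + wt p.*2.+2)) * (C / 2)); first by field.
rewrite !mulr_suml -!big_split; apply: eq_bigr => p _ /=.
rewrite (phi_affine (odd_le p : (0 < p.*2.+1 <= n)%N) It).
by rewrite (phi_affine (even_le p : (0 < p.*2.+2 <= n)%N) It) -/C -/T; field.
Qed.

(** The slopes combine to half the density slope, by its definition and [ratio_derivative]; the
    weight corrections (-1 + m - 1 - m)/4 cancel this half. *)
Lemma exponent_relation p :
  exponent p.*2.+1 + total exponent = exponent p.*2.+2 + exponent n.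
Proof.
have r := ratio_derivative p Is0.
rewrite total_exponent /exponent weight_odd weight_even weight_base.
have sr : slope p.*2.+1 s0 - slope p.*2.+2 s0 = slope 1 s0 - slope 2 s0.
  by rewrite /slope -!mulrBl r.
have dE : th s0 * inv_sigma s0
    = density_slope s0 / 2 - (slope 1 s0 - slope 2 s0) + slope n s0.
  by rewrite /density_slope; field.
by rewrite dE -sr; field.
Qed.

(** This is k = c_0 c_1 / (c_2 c_n) in logarithms. At [s0] the [phi] terms give w/2, balance removes
    the terms in harmonic time, and the weights, adding to -2, contribute ln k - w/2. *)
Lemma coefficient_relation :
  total log_coefficient + log_coefficient 1 - log_coefficient 2
  - log_coefficient n = ln k.
Proof.
have v := log_volume_affine Is0.
have c := ln_cosh_harmonic_time Is0; rewrite c in v.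
have bal := exponent_relation p0; rewrite /= in bal.
have wE : log_density s0 = 2 * (log_volume s0 + phi 1 s0 - phi 2 s0 - phi n s0).
  by [].
rewrite (_ : total log_coefficient = log_volume s0
   - total exponent * harmonic_time s0
   - m%:R / 2 * (ln k - log_density s0 / 2)); last by rewrite v; ring.
rewrite /log_coefficient w1 w2 weight_base.
have -> : total exponent = exponent 2 + exponent n - exponent 1.
  by rewrite -bal; ring.
by rewrite wE; field.
Qed.

Lemma coefficient_ratio p :
  log_coefficient p.*2.+1 - log_coefficient p.*2.+2
  = log_coefficient 1 - log_coefficient 2.
Proof.
rewrite /log_coefficient weight_odd weight_even w1 w2.
have e := exponent_relation p; have e0 := exponent_relation p0.
rewrite /= in e0.
have -> : exponent p.*2.+1 = exponent p.*2.+2 + exponent n - total exponent.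
  by rewrite -e addrK.
have -> : exponent 1 = exponent 2 + exponent n - total exponent.
  by rewrite -e0 addrK.
have -> : phi p.*2.+1 s0 = phi p.*2.+2 s0 + (phi 1 s0 - phi 2 s0).
  by rewrite -(ratio p Is0); ring.
by ring.
Qed.

(** The time-time equation contains theta'; the sum of all evolution equations, whose weights add to
    m, eliminates it. *)
Lemma hamiltonian_constraint t : I t ->
  th t ^+ 2 - (\sum_(p < m) (L p.*2.+1 t ^+ 2 + L p.*2.+2 t ^+ 2) + L n t ^+ 2)
  = m%:R / 2 * common_twist t.
Proof.
move=> It; have [eqt _ _ _] := eqs It.
have sumE : expansion_dt m D t + th t * (th t - L 0 t)
    = m%:R / 2 * common_twist t.
  rewrite /expansion_dt {1}/expansion mulrDl addrACA mulr_suml -big_split.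
  rewrite (@field_equationE n)// ?leqnn// weight_base big1 ?addr0// => p _ /=.
  have eo := @field_equationE p.*2.+1 t (odd_le p) It.
  have ee := @field_equationE p.*2.+2 t (even_le p) It.
  rewrite mulrDl addrACA eo ee weight_odd weight_even; ring.
by rewrite -sumE eqt; ring.
Qed.

(** The Hamiltonian constraint at [s0] times [inv_sigma]^2, which turns L_i into slopes and the
    twist into exp w; the conserved energy then supplies k^2. Here m/2 = (n - 1)/4. *)
Lemma exponent_constraint :
  total exponent ^+ 2 - total (fun i => exponent i ^+ 2) = m%:R / 2 * k ^+ 2.
Proof.
have sumC (x : R) : \sum_(p < m) x = m%:R * x.
  by rewrite sumr_const card_ord mulr_natl.
set y := density_slope s0; set r := inv_sigma s0.
have sr p : slope p.*2.+2 s0 = slope p.*2.+1 s0 - (slope 1 s0 - slope 2 s0).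
  by rewrite /slope -mulrBl -(ratio_derivative p Is0); ring.
have sqE : total (fun i => exponent i ^+ 2)
    = (\sum_(p < m) (L p.*2.+1 s0 ^+ 2 + L p.*2.+2 s0 ^+ 2) + L n s0 ^+ 2) * r ^+ 2
      + m%:R * (y ^+ 2 / 8 - y / 2 * (slope 1 s0 - slope 2 s0))
      + (m%:R / 2 * y * slope n s0 + m%:R ^+ 2 / 16 * y ^+ 2).
  rewrite /total (_ : \sum_(p < m) (exponent p.*2.+1 ^+ 2 + exponent p.*2.+2 ^+ 2)
    = (\sum_(p < m) (L p.*2.+1 s0 ^+ 2 + L p.*2.+2 s0 ^+ 2)) * r ^+ 2
      + m%:R * (y ^+ 2 / 8 - y / 2 * (slope 1 s0 - slope 2 s0))).
    by rewrite /exponent weight_base /slope -/y -/r; field.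
  rewrite mulr_suml -sumC -big_split; apply: eq_bigr => p _ /=.
  have -> : slope 1 s0 - slope 2 s0 = slope p.*2.+1 s0 - slope p.*2.+2 s0.
    by rewrite sr; ring.
  by rewrite /exponent weight_odd weight_even /slope -/y -/r; field.
have dE : slope 1 s0 - slope 2 s0 = y / 2 - th s0 * r + slope n s0.
  by rewrite /y /density_slope -/r; field.
have kE : 4 * k ^+ 2 = 4 * expR (log_density s0) + y ^+ 2.
  by rewrite -energyE// -/y; ring.
have -> : k ^+ 2 = (4 * k ^+ 2) / 4 by field.
rewrite total_exponent -/y -/r sqE dE kE -common_twistE -/r.
have := hamiltonian_constraint Is0.
set S := _ + L n s0 ^+ 2 => hc.
have -> : S = th s0 ^+ 2 - m%:R / 2 * common_twist s0 by rewrite -hc; ring.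
by field.
Qed.

(** The factor tau'^2 at index 0 is the effect of the time change on the squared lapse. *)
Lemma vacuum_profile : exists (c h : nat -> R) (tau : R -> R),
  [/\ vacuum_constants n c h, exponent_balance n h,
      forall s, I s -> derivable tau s 1 /\ 0 < derive1 tau s
    & forall i s, (i <= n)%N -> I s ->
        f i s = (if i is 0 then derive1 tau s ^+ 2 else 1)
          * profile m (fun i => ln (c i)) (exponents m h) (kconst n c) i (tau s)].
Proof.
(* Since dtau/dt = N / (a_1 ... a_n), the lapse relative to tau is a_1 ... a_n, so ln c_0 is the sum
   of the other logarithms. *)
pose lc i := if i is 0 then total log_coefficient else log_coefficient i.
pose c i := expR (lc i).
have lncE i : ln (c i) = lc i by rewrite expRK.
have kE : kconst n c = k.
  rewrite -[RHS]lnK ?posrE ?frequency_gt0// -coefficient_relation.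
  by rewrite /kconst /c -!expRD -expRN -expRD; congr expR; rewrite /lc /=; ring.
have trE : \tr (hmx n exponent) = total exponent by rewrite trace_hmx.
have tauD s : I s -> derive1 harmonic_time s = (inv_sigma s)^-1.
  by move=> /harmonic_time_derivative/derive1_val.
exists c, exponent, harmonic_time; split.
- split.
  + by move=> i _; exact: expR_gt0.
  + rewrite /= doubleK => -[//|p] /andP[_ pm].
    rewrite /c -!expRN -!expRD; congr expR.
    by rewrite /=; exact: (coefficient_ratio (Ordinal pm)).
  + rewrite kE trE trace_hmx_sqr -/(total (fun i => exponent i ^+ 2)).
    by rewrite exponent_constraint /= -muln2 natrM; field.
- by apply/balanceP => p; rewrite trE; exact: exponent_relation.
- move=> s Is; rewrite tauD// invr_gt0 inv_sigma_gt0; split=> //.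
  by have [] := harmonic_time_derivative Is.
- move=> i s il Is; rewrite fE// tauD// /profile kE lncE.
  case: i il => [|i] il /=; last first.
    by rewrite mul1r (phi_affine (il : (0 < i.+1 <= n)%N) Is); congr expR; field.
  rewrite trE weight0 -expRN -expRM_natl -expRD; congr expR.
  by rewrite /log_volume -/(log_volume s) (log_volume_affine Is); field.
Qed.

End Integration.

(** * From diagonal metrics to the theorem *)

Lemma diag_metricE (R : realType) (m : nat) (N : R -> R) (a : nat -> R -> R) :
  diag_metric m.*2.+1 N a
  = squares_metric (fun i t => (if i is 0 then N t else a i t) ^+ 2).
Proof.
apply/funext => y; rewrite /diag_metric /squares_metric; congr (_ + _).
by apply: eq_big_nat => -[].
Qed.

(** [vacuum_profile] applies to the logarithms of N and the a_i. The metrics then agree entry by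
    entry, as [met] involves only the squared factors and x_n. *)
Lemma diag_metric_vacuum (R : realType) (m : nat) (I : set R)
    (N : R -> R) (a : nat -> R -> R) (n := m.*2.+1) :
  (0 < m)%N -> open I -> is_interval I -> I !=set0 ->
  positive_on I N -> twice_derivable_on I N ->
  (forall i, (1 <= i <= n)%N ->
     positive_on I (a i) /\ twice_derivable_on I (a i)) ->
  (forall p, (1 <= p <= n.-1./2)%N -> forall t, I t ->
     a p.*2.-1 t / a p.*2 t = a 1%N t / a 2%N t) ->
  ricci_flat_on I (diag_metric n N a) ->
  exists (c h : nat -> R) (tau : R -> R),
    [/\ vacuum_constants n c h,
        exponent_balance n h,
        forall s, I s -> derivable tau s 1 /\ 0 < derive1 tau s
      & forall y : 'rV[R]_n.+1, I (y ord0 ord0) ->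
          diag_metric n N a y = time_pullback tau (vacuum_metric n c h) y].
Proof.
move=> m0 I_open I_itv [s0 Is0] N0 ND aD ratio; rewrite {}/n in aD ratio *.
rewrite diag_metricE => flat.
pose A i := if i is 0 then N else a i.
pose f i t := A i t ^+ 2; pose L i t := derive1 (A i) t / A i t.
have AE : (fun i t => (if i is 0 then N t else a i t) ^+ 2) = f.
  by apply/funext => -[].
rewrite AE in flat *.
have AP i t : (i <= m.*2.+1)%N -> I t ->
    [/\ 0 < A i t, derivable (A i) t 1 & derivable (derive1 (A i)) t 1].
  case: i => [_|i il] It /=; first by have [] := ND _ It; split=> //; exact: N0.
  by have [ai0 aid] := aD i.+1 il; have [] := aid _ It; split=> //; exact: ai0.
have AD i t : (i <= m.*2.+1)%N -> I t ->
    is_derive t (1 : R) (A i) (L i t * A i t).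
  move=> il It; have [A0 Ad _] := AP i t il It.
  by rewrite divfK ?gt_eqF//; exact: derive1P.
have LD i t : (i <= m.*2.+1)%N -> I t ->
    is_derive t (1 : R) (L i) (derive1 (L i) t).
  move=> il It; have [A0 Ad Ad2] := AP i t il It.
  have A00 : A i t != 0 by rewrite gt_eqF.
  have h := is_derive1M (derive1P Ad2) (is_derive1V A00 (derive1P Ad)).
  by apply: derive1P; case: h.
have fLD : log_derivatives m.*2.+1 I f L (fun i => derive1 (L i)).
  move=> i t il It; have [A0 _ _] := AP i t il It; split.
  - by rewrite expf_neq0// gt_eqF.
  - by apply: (is_derive_eq (is_derive1X 2 (AD i t il It))); rewrite /f /=; ring.
  - exact: LD.
have eqs := (ricci_flat_squares I_open fLD).1 flat.
have fphi i t : (i <= m.*2.+1)%N -> I t -> f i t = expR (2 * ln (A i t)).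
  by move=> il It; have [A0 _ _] := AP i t il It; rewrite expRM_natl lnK.
have phiD i t : (i <= m.*2.+1)%N -> I t ->
    is_derive t (1 : R) (fun t => ln (A i t)) (L i t).
  move=> il It; have [A0 _ _] := AP i t il It.
  apply: (is_derive_eq (is_derive1_lnf A0 (AD i t il It))).
  by rewrite mulfK// gt_eqF.
have lnratio (p : 'I_m) t : I t ->
    ln (A p.*2.+1 t) - ln (A p.*2.+2 t) = ln (A 1%N t) - ln (A 2%N t).
  move=> It; have pm := ltn_ord p; have := ratio p.+1.
  rewrite /= doubleK pm => /(_ isT t It) e.
  have Apos i : (0 < i <= m.*2.+1)%N -> 0 < a i t.
    by case: i => // i il; have [] := AP i.+1 t il It.
  rewrite /= -!ln_div ?posrE ?e// Apos//; lia.
have [c [h [tau [vc bal tauD fEE]]]] :=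
  @vacuum_profile R m I f (fun i t => ln (A i t)) L _ s0 m0 I_open I_itv Is0
    fphi phiD LD lnratio eqs.
have [c0 _ _] := vc.
exists c, h, tau; split=> // y Iy; apply/matrixP => i j.
have [u ->] := slot_ord_surj i; have [v ->] := slot_ord_surj j.
rewrite squares_metricE /time_pullback mul_mx_diag mxE mul_diag_mx mxE.
rewrite vacuum_metricE// squares_metricE !mxE eqxx.
set t := y ord0 ord0 in Iy *; set z := y ord0 ord_max.
have timeE (w : slot m) :
    (slot_ord w == ord0) = (if w is time then true else false).
  by rewrite -val_eqE /= val_slot_ord; case: w => // p [].
(* The last coordinate is not time, so the pullback leaves x_n unchanged. *)
rewrite -[ord_max]/(slot_ord (@base m)) !timeE.
have fEt i' : (i' <= m.*2.+1)%N -> _ := fun il => fEE i' t il Iy.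
case: u v => [||p b] [||q d] /=; rewrite ?(mulr0, mul0r, mulr1, mul1r)//.
- by rewrite fEt//=; ring.
- by rewrite fEt//= mul1r.
- have pm := ltn_ord p; congr (_ * _).
  rewrite /met_block; case: b d => -[]; rewrite !fEt ?mul1r//; lia.
Qed.

Theorem mainTheorem2 (R : realType) (n : nat) (n_ge3 : (3 <= n)%N)
    (n_odd : odd n) (I : set R) (I_open : open I) (I_itv : is_interval I)
    (I_neq0 : I !=set0) :
  (forall c h : nat -> R, vacuum_constants n c h ->
     (ricci_flat_on I (vacuum_metric n c h) <-> exponent_balance n h))
  /\
  (forall (N : R -> R) (a : nat -> R -> R),
     positive_on I N -> twice_derivable_on I N ->
     (forall i, (1 <= i <= n)%N ->
        positive_on I (a i) /\ twice_derivable_on I (a i)) ->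
     (forall p, (1 <= p <= n.-1./2)%N -> forall t, I t ->
        a p.*2.-1 t / a p.*2 t = a 1%N t / a 2%N t) ->
     ricci_flat_on I (diag_metric n N a) ->
     exists (c h : nat -> R) (tau : R -> R),
       [/\ vacuum_constants n c h,
           exponent_balance n h,
           forall s, I s -> derivable tau s 1 /\ 0 < derive1 tau s
         & forall y : 'rV[R]_n.+1, I (y ord0 ord0) ->
             diag_metric n N a y = time_pullback tau (vacuum_metric n c h) y]).
Proof.
(* For odd n the number of blocks (n - 1)/2 is [n./2]. *)
have nE : n = n./2.*2.+1 by rewrite -[LHS]odd_double_half n_odd.
have m0 : (0 < n./2)%N by rewrite half_gt0 ltnW.
move: (n./2) nE m0 => m nE m0; subst n.
split=> [c h|N a]; first exact: vacuum_metric_flat.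
exact: diag_metric_vacuum.
Qed.
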